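(* Let $z=1$ and $e_0=\inf_{v\in\mathcal{B}_1}E[v]$. There is $u\in\mathcal{B}_1$ with $E[u]=e_0$.
   Context: $H^1$ is the space of functions $u:\mathbb{R}\to\mathbb{R}$ with $\|u'\|_2^2+\|u\|_2^2<\infty$. Let $G(x,y)=\frac12(|x|+|y|-|x-y|)$, which equals $\min\{|x|,|y|\}$ if $xy>0$ and $0$ otherwise, and let $C[f]=\iint_{\mathbb{R}^2}G(x,y)f(x)f(y)\,dx\,dy$. Define $\mathcal{B}=\{u\in H^1:C[u^2]<\infty\}$ and $\mathcal{B}_1=\{u\in\mathcal{B}:\|u\|_2=1\}$. For $z=1$ (point charge background $\rho=-\delta_0$) the energy is $E[u]=\int_{\mathbb{R}}|u'(x)|^2\,dx+C[u^2]$. *)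

(* Defs.v *)
From HB Require Import structures.
From mathcomp Require Import all_boot all_order all_algebra.
From mathcomp Require Import all_classical all_reals all_analysis.

Set Implicit Arguments.
Unset Strict Implicit.
Unset Printing Implicit Defensive.

Import Order.TTheory GRing.Theory Num.Theory.
Import numFieldNormedType.Exports.

Local Open Scope classical_set_scope.
Local Open Scope ring_scope.

(* Functions on the line are used in place of their a.e. classes: everything
   below depends only on the class. *)

Definition test_function {R : realType} (phi : R -> R) : Prop :=
  [/\ forall x : R, derivable phi x 1,
      continuous (derive1 phi)
    & exists M : R, forall x : R, M < `|x| -> phi x = 0].

(* The test functions are C^1 with compact support, as in Brezis's one
   dimensional Sobolev spaces; by mollification, smooth ones define the same
   notion. *)
Definition is_weak_derivative {R : realType} (u g : R -> R) : Prop :=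
  [/\ locally_integrable setT u,
      locally_integrable setT g
    & forall phi : R -> R, test_function phi ->
        \int[@lebesgue_measure R]_x (u x * derive1 phi x) =
        - \int[@lebesgue_measure R]_x (g x * phi x)].

(* A chosen version of the a.e. unique weak derivative; the zero function if
   there is none. *)
Definition weak_derivative {R : realType} (u : R -> R) : R -> R :=
  xget (fun=> 0) [set g | is_weak_derivative u g].

Definition H1 {R : realType} : set (R -> R) :=
  [set u | u \in Lfun (@lebesgue_measure R) 2%:E /\
           exists2 g : R -> R, is_weak_derivative u g &
             g \in Lfun (@lebesgue_measure R) 2%:E].

Definition G {R : realType} (x y : R) : R :=
  2^-1 * (`|x| + `|y| - `|x - y|).

Definition coulomb {R : realType} (f : R -> R) : \bar R :=
  (\int[@lebesgue_measure R \x @lebesgue_measure R]_p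
     (G p.1 p.2 * f p.1 * f p.2)%:E)%E.

Definition B {R : realType} : set (R -> R) :=
  [set u | H1 u /\ (coulomb (fun x => (u x ^+ 2)%R) < +oo)%E].

Definition B1 {R : realType} : set (R -> R) :=
  [set u | B u /\ ('N[@lebesgue_measure R]_2%:E[EFin \o u] = 1)%E].

(* For the point charge background - delta_0, i.e. z = 1. *)
Definition energy {R : realType} (u : R -> R) : \bar R :=
  (\int[@lebesgue_measure R]_x (`|weak_derivative u x| ^+ 2)%R%:E +
   coulomb (fun x => (u x ^+ 2)%R))%E.

Definition e0 {R : realType} : \bar R :=
  ereal_inf [set energy v | v in @B1 R].

(* Main.v *)
From HB Require Import structures.
Require Import Defs.
From mathcomp Require Import all_boot all_order all_algebra.
From mathcomp Require Import all_classical all_reals all_analysis.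
From mathcomp Require Import measurable_realfun ring lra.

(** Along a minimizing sequence, each of the two terms of the energy supplies
    one half of the compactness.

    The kinetic term bounds the squared L2 norm of the derivatives.  A function
    with a square integrable weak derivative g agrees almost everywhere with
    the continuous function whose increments are the integrals of g
    ([L2_representative]), so by Cauchy-Schwarz the functions of the sequence
    are uniformly Hoelder of exponent 1/2 ([L2_primitive_hoelder_half]) and,
    having unit mass, uniformly bounded ([L2_primitive_bounded]).  Members
    w_k of the sequence, of index at least k, therefore converge to some u,
    uniformly on bounded sets ([hoelder_precompact]).

    The Coulomb term keeps the mass from escaping to infinity.  The kernel G is
    at least T on pairs of points that lie beyond distance T from the origin on
    the same side, so the Coulomb energy is at least T times the square of the
    mass carried beyond T on that side ([coulomb_tail]).  Hence the mass beyond
    T is small uniformly in k, and u has unit mass ([limit_mass]).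

    It remains to see that the energy does not increase in the limit.  For the
    Coulomb term this is Fatou's lemma on the plane.  For the kinetic term,
    weak compactness is replaced by a convexity argument: the derivatives of
    the functions that are within 1/(k+1) of u on [-k, k] form a decreasing
    sequence of convex sets; by the parallelogram identity, elements of nearly
    minimal norm in these sets form a Cauchy sequence in L2
    ([nested_convex_min]), and its limit has to be the derivative of u
    ([L2_primitive_limit]).

    The energy refers to a chosen weak derivative.  The choice is harmless
    because weak derivatives are unique almost everywhere
    ([weak_derivative_unique]), which rests on the fundamental lemma of the
    calculus of variations.  The infimum is finite because a normalized test
    function is admissible ([admissible_finite_energy]). *)

Set Implicit Arguments.
Unset Strict Implicit.
Unset Printing Implicit Defensive.

Import Order.TTheory GRing.Theory Num.Theory.
Import numFieldNormedType.Exports.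

Local Open Scope classical_set_scope.
Local Open Scope ring_scope.

(** * Square integrals and convexity *)

Section SquareIntegrals.
Context d (T : measurableType d) (R : realType).
Variable mu : {measure set T -> \bar R}.
Implicit Types (f g : T -> R).

Definition sqint f : \bar R := (\int[mu]_x (f x ^+ 2)%:E)%E.

Lemma sqint_ge0 f : (0 <= sqint f)%E.
Proof. by apply: integral_ge0 => x _; rewrite lee_fin sqr_ge0. Qed.

Lemma ae_imp (P Q : T -> Prop) : (forall x, P x -> Q x) ->
  {ae mu, forall x, P x} -> {ae mu, forall x, Q x}.
Proof. by move=> PQ; apply: filterS. Qed.

(** Fatou's lemma in the form in which semicontinuity is used below: a bound
    that holds eventually along the sequence passes to the limit. *)
Lemma fatou_ae (f_ : nat -> T -> R) f (M : \bar R) :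
  (forall n, measurable_fun setT (f_ n)) -> (forall n x, 0 <= f_ n x) ->
  measurable_fun setT f -> (forall x, 0 <= f x) ->
  {ae mu, forall x, f_ ^~ x @ \oo --> f x} ->
  (\forall n \near \oo, (\int[mu]_x (f_ n x)%:E <= M)%E) ->
  (\int[mu]_x (f x)%:E <= M)%E.
Proof.
move=> mf_ f_0 mf f0 cvf leM.
have mF n : measurable_fun setT (EFin \o f_ n) by apply/measurable_EFinP.
have f_0E n x : setT x -> (0 <= (f_ n x)%:E)%E by rewrite lee_fin.
rewrite (@ge0_ae_eq_integral _ _ _ mu setT _
  (fun x => limn_einf (fun n => (f_ n x)%:E))) //.
- apply: le_trans (@fatou _ _ _ mu setT measurableT _ mF f_0E) _.
  rewrite limn_einf_lim; apply: lime_le; first exact: is_cvg_einfs.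
  near=> n; apply: (@le_trans _ _ (\int[mu]_x (f_ n x)%:E)%E); last by near: n.
  by apply: ereal_inf_lbound; exists n => /=.
- exact/measurable_EFinP.
- apply: (eq_measurable_fun (fun x => (- limn_esup (fun n => - (f_ n x)%:E))%E)).
    by move=> x _; rewrite limn_esupN oppeK.
  apply: (@measurableT_comp _ _ _ _ _ _ (-%E : \bar R -> \bar R)) => //.
  apply: measurable_fun_limn_esup => n.
  by apply: (@measurableT_comp _ _ _ _ _ _ (-%E : \bar R -> \bar R)) (mF n).
- by move=> x _; rewrite lee_fin.
- move=> x _; rewrite limn_einf_lim; apply: lime_ge; first exact: is_cvg_einfs.
  by near=> n; apply: le_ereal_inf_tmp => _ [m /= _ <-]; exact: f_0E.
- apply: filterS cvf => x cvx _.
  have cE : (f_ n x)%:E @[n --> \oo] --> (f x)%:E.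
    by apply: cvg_EFin cvx; exact: nearW.
  by have [-> _] := cvg_limn_einf_sup cE.
Unshelve. all: by end_near. Qed.

Lemma measurable_sqE f : measurable_fun setT f ->
  measurable_fun setT (fun x => (f x ^+ 2)%:E : \bar R).
Proof. by move=> mf; apply/measurable_EFinP; exact: measurable_funX. Qed.

Lemma sqint_parallelogram f g : measurable_fun setT f -> measurable_fun setT g ->
  (sqint (f \+ g)%R + sqint (f \- g)%R = 2%:E * sqint f + 2%:E * sqint g)%E.
Proof.
move=> mf mg.
have sq0 (k : T -> R) x : setT x -> (0 <= (k x ^+ 2)%:E)%E.
  by rewrite lee_fin sqr_ge0.
have m2 (k : T -> R) : measurable_fun setT k ->
    measurable_fun setT (fun x => (2%:E * (k x ^+ 2)%:E)%E : \bar R).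
  by move=> mk; apply: measurable_funeM; exact: measurable_sqE.
have sq20 (k : T -> R) x : setT x -> (0 <= 2%:E * (k x ^+ 2)%:E)%E.
  by move=> _; rewrite -EFinM lee_fin mulr_ge0// sqr_ge0.
rewrite /sqint.
rewrite -(ge0_integralZl mu measurableT (measurable_sqE mf) (sq0 f))//.
rewrite -(ge0_integralZl mu measurableT (measurable_sqE mg) (sq0 g))//.
rewrite -(ge0_integralD mu measurableT (sq20 f) (m2 _ mf) (sq20 g) (m2 _ mg)).
rewrite -(ge0_integralD mu measurableT (sq0 _) (measurable_sqE (measurable_funD mf mg))
  (sq0 _) (measurable_sqE (measurable_funB mf mg))).
by apply: eq_integral => x _; rewrite -!EFinM -!EFinD; congr EFin => /=; ring.
Qed.

Lemma summable_telescope_cvg (u : R^nat) (C : R) :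
  (forall n, \sum_(0 <= k < n) `|u k.+1 - u k| <= C) -> cvgn u.
Proof.
move=> uC.
have H : cvgn (series (telescope u)).
  apply: normed_cvg; apply: nondecreasing_is_cvgn.
    by apply: nondecreasing_series => n _ _; exact: normr_ge0.
  by exists C => _ [n _ <-]; exact: uC.
rewrite (_ : u = fun n => u 0%N + series (telescope u) n); last first.
  by apply/funext => n; exact: eq_sum_telescope.
by apply: is_cvgD => //; exact: is_cvg_cst.
Qed.

Lemma sum_halfpow_le (n : nat) : \sum_(0 <= k < n) (2^-1 : R) ^+ k <= 2.
Proof.
have := @geometric_le_lim R n 1 2^-1 ler01.
rewrite /geometric /series/= => H.
have -> : \sum_(0 <= k < n) (2^-1 : R) ^+ k = \sum_(0 <= k < n) 1 * 2^-1 ^+ k.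
  by apply: eq_bigr => k _; rewrite mul1r.
have e2 : 1 / (1 - 2^-1) = 2 :> R by field; lra.
by rewrite -[leRHS]e2; apply: H => //; rewrite ger0_norm; lra.
Qed.

(** Half of the Riesz-Fischer theorem.  The rate makes the increments summable
    at almost every point, because a weighted sum of their squares has a finite
    integral. *)
Lemma ae_cvg_rapid_L2 (h : nat -> T -> R) :
  (forall k, measurable_fun setT (h k)) ->
  (forall k, sqint (h k.+1 \- h k)%R <= ((4^-1) ^+ k)%:E)%E ->
  {ae mu, forall x, cvgn (h ^~ x)}.
Proof.
move=> mh hC.
(* The weight 2^k still leaves a summable series of integrals, and it controls
   the increments t themselves because |t| <= 2^k t^2 + 2^-k. *)
pose D k x := 2 ^+ k * (h k.+1 x - h k x) ^+ 2.
have mD k : measurable_fun setT (EFin \o D k).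
  apply/measurable_EFinP; apply: measurable_funM => //; apply: measurable_funX.
  exact: measurable_funB.
have D0 k x : setT x -> (0 <= (EFin \o D k) x)%E.
  by move=> _; rewrite lee_fin mulr_ge0 ?sqr_ge0// exprn_ge0.
pose F x := (\sum_(k <oo) (D k x)%:E)%E.
have intF : (\int[mu]_x F x <= 2%:E)%E.
  rewrite /F (@integral_nneseries _ _ _ mu _ measurableT (fun k => EFin \o D k))//.
  apply: lime_le.
    by apply: is_cvg_nneseries => n _ _; apply: integral_ge0; exact: D0.
  apply: nearW => n; apply: (@le_trans _ _ (\sum_(0 <= k < n) (2^-1 : R) ^+ k)%:E);
    last by rewrite lee_fin sum_halfpow_le.
  rewrite -sumEFin; apply: lee_sum => k _.
  under eq_integral do rewrite /= EFinM.
  rewrite ge0_integralZl//; last 2 first.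
  - by apply: measurable_sqE; exact: measurable_funB.
  - by move=> x _; rewrite lee_fin sqr_ge0.
  apply: (@le_trans _ _ ((2 ^+ k)%:E * ((4^-1) ^+ k)%:E)%E).
    by apply: lee_wpmul2l (hC k); rewrite lee_fin exprn_ge0.
  by rewrite -EFinM -exprMn lee_fin (_ : 2 * 4^-1 = 2^-1 :> R)//; lra.
have mF : measurable_fun setT F.
  by apply: ge0_emeasurable_sum => [k x Dx _|k _]; [exact: D0|exact: mD].
have Fint : mu.-integrable setT F.
  apply/integrableP; split => //.
  have F0 x : (0 <= F x)%E by apply: nneseries_ge0 => k _ _; exact: D0.
  under eq_integral do rewrite gee0_abs//.
  by apply: le_lt_trans intF _; rewrite ltry.
apply: filterS (integrable_ae measurableT Fint) => x /(_ I) Fx.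
apply: (@summable_telescope_cvg _ (fine (F x) + 2)) => n.
apply: (@le_trans _ _ (\sum_(0 <= k < n) (D k x + 2^-1 ^+ k))).
  apply: ler_sum => k _; rewrite /D.
  set a := h k.+1 x - h k x.
  have p0 : 0 < (2 : R) ^+ k by rewrite exprn_gt0.
  rewrite exprVn -(ler_pM2l p0) mulrDr mulfV ?gt_eqF//.
  have -> : 2 ^+ k * (2 ^+ k * a ^+ 2) = (2 ^+ k * `|a|) ^+ 2.
    by rewrite exprMn real_normK ?num_real//; ring.
  by nra.
rewrite big_split/= lerD ?sum_halfpow_le// -lee_fin -sumEFin fineK//.
by apply: nneseries_lim_ge => k _ _; exact: D0.
Qed.

(** Completeness of L2 along sequences with a geometric Cauchy rate; Fatou
    transfers the Cauchy estimate from the differences to the limit. *)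
Lemma L2_limit (h : nat -> T -> R) :
  (forall k, measurable_fun setT (h k)) ->
  (forall i j, (i <= j)%N -> sqint (h j \- h i)%R <= ((4^-1) ^+ i)%:E)%E ->
  exists2 g : T -> R, measurable_fun setT g &
    {ae mu, forall x, h ^~ x @ \oo --> g x} /\
    forall i, (sqint (g \- h i)%R <= ((4^-1) ^+ i)%:E)%E.
Proof.
move=> mh hC.
pose g x := fine (limn_esup (fun k => (h k x)%:E)).
have mg : measurable_fun setT g.
  apply: measurableT_comp => //; apply: measurable_fun_limn_esup => k.
  exact/measurable_EFinP.
have cvg_h : {ae mu, forall x, h ^~ x @ \oo --> g x}.
  have hS k : (sqint (h k.+1 \- h k)%R <= ((4^-1) ^+ k)%:E)%E by exact: hC.
  apply: filterS (ae_cvg_rapid_L2 mh hS) => x /cvg_ex[l hl].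
  have hlE : (h k x)%:E @[k --> \oo] --> l%:E by apply: cvg_EFin hl; exact: nearW.
  by rewrite /g; have [_ ->] := cvg_limn_einf_sup hlE.
exists g => //; split => // i.
apply: (@fatou_ae (fun j x => (h j x - h i x) ^+ 2)).
- by move=> j; apply: measurable_funX; exact: measurable_funB.
- by move=> j x; exact: sqr_ge0.
- by apply: measurable_funX; exact: measurable_funB.
- by move=> x; exact: sqr_ge0.
- apply: filterS cvg_h => x hx; rewrite !expr2.
  have hB : h k x - h i x @[k --> \oo] --> g x - h i x.
    by apply: cvgB => //; exact: cvg_cst.
  exact: cvgM.
- by near=> j; apply: hC; near: j; exact: nbhs_infty_ge.
Unshelve. all: by end_near. Qed.


Lemma sqintZ (c : R) f : measurable_fun setT f ->
  sqint (fun x => c * f x) = ((c ^+ 2)%:E * sqint f)%E.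
Proof.
move=> mf; rewrite /sqint -ge0_integralZl//.
- by apply: eq_integral => x _; rewrite -EFinM exprMn.
- exact: measurable_sqE.
- by move=> x _; rewrite lee_fin sqr_ge0.
- by rewrite lee_fin sqr_ge0.
Qed.

(** The infima of the square integral over the sets [K k] increase with k and
    are at most [D]; [m] is their limit.  Each [h i] is a near minimizer in a set
    [K k] so far out that the infimum has almost reached [m].  Two such
    functions lie in a common [K k] on which the square integral is at least
    almost [m], which is what the parallelogram identity needs. *)
Lemma nested_near_minimizers (K : nat -> set (T -> R)) (D : R) :
  (forall k l, (k <= l)%N -> K l `<=` K k) ->
  (forall k (e : R), 0 < e -> exists2 g, K k g & (sqint g <= (D + e)%:E)%E) ->
  exists2 h : nat -> T -> R, forall i, K i (h i) &
  exists2 m : R, m <= D & forall i j, (i <= j)%N ->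
    (sqint (h i) <= (m + 4^-1 ^+ i / 8)%:E)%E /\
    exists2 k, K k (h i) /\ K k (h j) &
      forall f, K k f -> ((m - 4^-1 ^+ i / 8)%:E <= sqint f)%E.
Proof.
move=> Kle Kne.
pose r k := fine (ereal_inf [set sqint g | g in K k]).
have inf_ge0 k : (0 <= ereal_inf [set sqint g | g in K k])%E.
  by apply: le_ereal_inf_tmp => _ [g _ <-]; exact: sqint_ge0.
have inf_le k : (ereal_inf [set sqint g | g in K k] <= D%:E)%E.
  apply/lee_addgt0Pr => e e0; have [g Kg gD] := Kne k e e0.
  by rewrite -EFinD; apply: le_trans gD; apply: ereal_inf_lbound; exists g.
have rE k : ereal_inf [set sqint g | g in K k] = (r k)%:E.
  by rewrite fineK// ge0_fin_numE//; apply: le_lt_trans (inf_le k) _; rewrite ltry.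
have rD k : r k <= D by rewrite -lee_fin -rE.
have r_nd k l : (k <= l)%N -> r k <= r l.
  move=> kl; rewrite -lee_fin -!rE; apply: ereal_inf_le_tmp => _ [g Kg <-].
  by exists g => //; exact: Kle kl _ Kg.
have rsup : has_sup (range r).
  by split; [exists (r 0%N), 0%N | exists D => _ [k _ <-]].
pose m := sup (range r).
have r_le_m k : r k <= m by apply: ub_le_sup; [exact: rsup.2 | exists k].
have q0 i : 0 < (4^-1 : R) ^+ i / 8 by rewrite divr_gt0// exprn_gt0.
have qle i j : (i <= j)%N -> (4^-1 : R) ^+ j / 8 <= 4^-1 ^+ i / 8.
  by move=> ij; rewrite ler_pM2r//; apply: ler_wiXn2l => //; lra.
have exk i : exists k, (i <= k)%N /\ m - 4^-1 ^+ i / 8 <= r k.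
  have [_ [k _ <-] kr] := sup_adherent (q0 i) rsup.
  exists (maxn i k); split; first exact: leq_maxl.
  by apply: le_trans (ltW kr) _; apply: r_nd; exact: leq_maxr.
have [k /all_and2[ik rk]] := choice exk.
have exh i : exists h, K (k i) h /\ (sqint h <= (m + 4^-1 ^+ i / 8)%:E)%E.
  have fn : ereal_inf [set sqint g | g in K (k i)] \is a fin_num by rewrite rE.
  have [_ [h Kh <-]] := lb_ereal_inf_adherent (q0 i) fn.
  rewrite rE -EFinD => hr; exists h; split => //; apply: le_trans (ltW hr) _.
  by rewrite lee_fin lerD2r.
have [h /all_and2[Kh hm]] := choice exh.
exists h; first by move=> i; apply: Kle (ik i) _ (Kh i).
exists m; first by apply: ge_sup => [|_ [j _ <-]//]; exact: rsup.1.
move=> i j ij; split => //.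
have sub l : (minn (k i) (k j) <= l)%N -> K l `<=` K (minn (k i) (k j)) by exact: Kle.
exists (minn (k i) (k j)).
  split; first by apply: (Kle _ _ (geq_minl _ _)); exact: Kh.
  by apply: (Kle _ _ (geq_minr _ _)); exact: Kh.
move=> f Kf; apply: (@le_trans _ _ (r (minn (k i) (k j)))%:E); last first.
  by rewrite -rE; apply: ereal_inf_lbound; exists f.
rewrite lee_fin; case: (leqP (k i) (k j)) => _; first exact: rk.
by apply: le_trans (rk j); rewrite lerD2l lerN2 qle.
Qed.

(** A substitute for weak sequential compactness of balls in L2.  The midpoint
    of two near minimizers [h i], [h j] cannot have a much smaller norm than
    they have, so by the parallelogram identity they are close in norm. *)
Lemma nested_convex_min (K : nat -> set (T -> R)) (D : R) :
  (forall k f, K k f -> measurable_fun setT f) ->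
  (forall k l, (k <= l)%N -> K l `<=` K k) ->
  (forall k f g, K k f -> K k g -> K k (fun x => 2^-1 * (f x + g x))) ->
  (forall k (e : R), 0 < e -> exists2 g, K k g & (sqint g <= (D + e)%:E)%E) ->
  exists2 g : T -> R, measurable_fun setT g /\ (sqint g <= D%:E)%E &
  exists2 h : nat -> T -> R, forall i, K i (h i) &
    forall i, (sqint (g \- h i)%R <= (4^-1 ^+ i)%:E)%E.
Proof.
move=> mK Kle Kmid Kne.
have [h Kh [m mD hm]] := nested_near_minimizers Kle Kne.
have mh i : measurable_fun setT (h i) by exact: mK (Kh i).
have sqfin i : sqint (h i) \is a fin_num.
  rewrite ge0_fin_numE ?sqint_ge0//; have [hi _] := hm i i (leqnn i).
  by apply: le_lt_trans hi _; rewrite ltry.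
have hC i j : (i <= j)%N -> (sqint (h j \- h i)%R <= (4^-1 ^+ i)%:E)%E.
  move=> ij; have [hi [k [Ki Kj]]] := hm i j ij; have [hj _] := hm j j (leqnn j).
  move=> /(_ _ (Kmid _ _ _ Kj Ki)).
  rewrite sqintZ; last exact: measurable_funD.
  have := sqint_parallelogram (mh j) (mh i).
  have qle : (4^-1 : R) ^+ j <= 4^-1 ^+ i by apply: ler_wiXn2l => //; lra.
  have := sqint_ge0 (h j \- h i)%R; have := sqint_ge0 (h j \+ h i)%R.
  rewrite (_ : (fun x => h j x + h i x) = h j \+ h i)//.
  move: hi hj (sqfin i) (sqfin j).
  move: (sqint (h i)) (sqint (h j)) => [a| |] [b| |]// + + _ _.
  move: (sqint (h j \+ h i)%R) (sqint (h j \- h i)%R) => [c| |] [e| |]//.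
  rewrite -?EFinM -?EFinD !lee_fin => ha hb c0 e0 [ce] mc.
  move: (4^-1 ^+ i) (4^-1 ^+ j) ha hb qle mc => p q; lra.
have [g mg [hg gC]] := L2_limit mh hC.
exists g; last by exists h.
split => //; apply/lee_addgt0Pr => e e0.
apply: (@fatou_ae (fun i x => h i x ^+ 2)).
- by move=> i; exact: measurable_funX.
- by move=> i x; exact: sqr_ge0.
- exact: measurable_funX.
- by move=> x; exact: sqr_ge0.
- by apply: filterS hg => x hx; under eq_fun do rewrite expr2; rewrite expr2; exact: cvgM.
- have q4 : `|4^-1 : R| < 1 by rewrite ger0_norm; lra.
  have := @cvg_geometric R 1 _ q4.
  move=> /cvgr_lt/(_ _ e0); apply: filterS => i /=; rewrite mul1r => ie.
  have [hi _] := hm i i (leqnn i); apply: le_trans hi _.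
  rewrite -EFinD lee_fin lerD//.
  have : 0 <= (4^-1 : R) ^+ i by rewrite exprn_ge0.
  by move: (4^-1 ^+ i) ie => p; lra.
Qed.

Lemma integrableRD (D : set T) f g : measurable D ->
  mu.-integrable D (EFin \o f) -> mu.-integrable D (EFin \o g) ->
  mu.-integrable D (EFin \o (fun x => f x + g x)).
Proof. by move=> mD fi gi; exact: (integrableD mD fi gi). Qed.

Lemma integrableRB (D : set T) f g : measurable D ->
  mu.-integrable D (EFin \o f) -> mu.-integrable D (EFin \o g) ->
  mu.-integrable D (EFin \o (fun x => f x - g x)).
Proof. by move=> mD fi gi; exact: (integrableB mD fi gi). Qed.

Lemma integrableRZ (D : set T) (c : R) f : measurable D ->
  mu.-integrable D (EFin \o f) -> mu.-integrable D (EFin \o (fun x => c * f x)).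
Proof. by move=> mD fi; exact: (integrableZl mD c fi). Qed.

Lemma Rintegral_dominated_cvg (f_ : nat -> T -> R) f g :
  (forall n, measurable_fun setT (f_ n)) -> measurable_fun setT f ->
  (forall x, f_ ^~ x @ \oo --> f x) -> mu.-integrable setT (EFin \o g) ->
  (forall n x, `|f_ n x| <= g x) ->
  (\int[mu]_x f_ n x) @[n --> \oo] --> \int[mu]_x f x.
Proof.
move=> mf_ mf cvf ig leg.
have m1 n : measurable_fun setT (EFin \o f_ n) by exact/measurable_EFinP.
have m2 : measurable_fun setT (EFin \o f) by exact/measurable_EFinP.
have cv : {ae mu, forall x, setT x -> (EFin \o f_ n) x @[n --> \oo] --> (EFin \o f) x}.
  by apply: aeW => x _; apply: cvg_EFin; [exact: nearW|exact: cvf].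
have le1 : {ae mu, forall x n, setT x -> (`|(EFin \o f_ n) x| <= (EFin \o g) x)%E}.
  by apply: aeW => x n _; rewrite /= lee_fin.
have [ifl _ H] := dominated_convergence measurableT m1 m2 cv ig le1.
apply: fine_cvg; rewrite fineK; first exact: H.
exact: (integrable_fin_num measurableT ifl).
Qed.

End SquareIntegrals.

Section BoundedKernel.
Context d1 d2 (T1 : measurableType d1) (T2 : measurableType d2) (R : realType).
Variables (m1 : {sigma_finite_measure set T1 -> \bar R}).
Variables (m2 : {sigma_finite_measure set T2 -> \bar R}).

(** Fubini's theorem for a product of two integrable functions coupled by a
    bounded kernel, which is all that integration by parts requires. *)
Lemma Rintegral_bounded_kernel (K : T1 * T2 -> R) (q : T1 -> R) (p : T2 -> R) :
  measurable_fun setT K -> (forall z, `|K z| <= 1) ->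
  m1.-integrable setT (EFin \o q) -> m2.-integrable setT (EFin \o p) ->
  \int[m1]_x (q x * \int[m2]_y (K (x, y) * p y)) =
  \int[m2]_y (p y * \int[m1]_x (K (x, y) * q x)).
Proof.
move=> mK K1 iq ip.
have mq : measurable_fun setT q by apply/measurable_EFinP; case/integrableP: iq.
have mp : measurable_fun setT p by apply/measurable_EFinP; case/integrableP: ip.
pose f z : \bar R := (q z.1 * (K z * p z.2))%:E.
have mf : measurable_fun setT f.
  apply/measurable_EFinP; apply: measurable_funM.
    by apply: measurableT_comp => //; exact: measurable_fst.
  apply: measurable_funM => //.
  by apply: measurableT_comp => //; exact: measurable_snd.
have iKp x : m2.-integrable setT (fun y => (K (x, y) * p y)%:E).
  apply: (le_integrable measurableT _ _ ip).
    apply/measurable_EFinP; apply: measurable_funM => //.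
    exact: (measurableT_comp mK (measurable_pair1 _)).
  by move=> y _; rewrite /= lee_fin normrM ler_piMl.
have iKq y : m1.-integrable setT (fun x => (K (x, y) * q x)%:E).
  apply: (le_integrable measurableT _ _ iq).
    apply/measurable_EFinP; apply: measurable_funM => //.
    exact: (measurableT_comp mK (measurable_pair2 _)).
  by move=> x _; rewrite /= lee_fin normrM ler_piMl.
have fi : (m1 \x m2)%E.-integrable setT f.
  apply/integrable12ltyP => //.
  have [_ qoo] := integrableP _ _ _ iq; have [_ poo] := integrableP _ _ _ ip.
  apply: (@le_lt_trans _ _ (\int[m1]_x (`|q x|%:E * \int[m2]_y `|p y|%:E))%E).
    apply: ge0_le_integral => //.
    - by move=> x _; exact: integral_ge0.
    - apply: (@measurable_fun_fubini_tonelli_F _ _ _ _ _ m2 (abse \o f)).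
        exact: measurableT_comp.
      by move=> z; exact: (abse_ge0 (f z)).
    - apply: emeasurable_funM; last exact: measurable_cst.
      by apply/measurable_EFinP; exact: measurableT_comp.
    move=> x _; rewrite -ge0_integralZl//.
      apply: ge0_le_integral => //.
      - apply: measurableT_comp => //.
        exact: (measurableT_comp mf (measurable_pair1 _)).
      - apply: measurable_funeM; apply/measurable_EFinP; exact: measurableT_comp.
      - move=> y _; rewrite -EFinM lee_fin !normrM ler_wpM2l//.
        by rewrite ler_piMl.
    by apply/measurable_EFinP; exact: measurableT_comp.
  under eq_integral do rewrite muleC.
  rewrite ge0_integralZl//; first by rewrite lte_mul_pinfty// ?integral_ge0// ge0_fin_numE ?integral_ge0.
  - by apply/measurable_EFinP; exact: measurableT_comp.
  - exact: integral_ge0.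
have HF := Fubini fi; rewrite /Rintegral.
have -> : (\int[m1]_x (q x * fine (\int[m2]_y (K (x, y) * p y)%:E))%:E =
    \int[m1]_x \int[m2]_y f (x, y))%E.
  apply: eq_integral => x _; rewrite EFinM fineK; last exact: integrable_fin_num (iKp x).
  by rewrite -integralZl//; under eq_integral do rewrite -EFinM.
rewrite HF; congr fine; apply: eq_integral => y _.
rewrite EFinM fineK; last exact: integrable_fin_num (iKq y).
rewrite -integralZl//; apply: eq_integral => x _.
by rewrite -EFinM /f/=; congr EFin; ring.
Qed.

End BoundedKernel.

(** * Test functions approximating the indicator of an interval *)

Section Bump.
Context {R : realType}.
Local Notation mu := (@lebesgue_measure R).
Implicit Types (f g u v w phi : R -> R).

(** A quadratic bound on the remainder, uniform in the increment, identifies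
    the derivative.  It holds for the square of the positive part without any
    separate treatment of the point 0. *)
Lemma is_derive_quadratic f (x l C : R) :
  (forall h, `|f (x + h) - f x - l * h| <= C * h ^+ 2) -> is_derive x 1 f l.
Proof.
move=> fC.
have C0 : 0 <= C by have := le_trans (normr_ge0 _) (fC 1); rewrite expr1n mulr1.
have cvl : (fun h : R => h^-1 *: ((f \o shift x) (h *: 1) - f x)) @ 0^' --> l.
  apply/cvgrPdist_le => e e0; near=> h.
  have h0 : h != 0 by near: h; exact: nbhs_dnbhs_neq.
  have he : (C + 1) * `|h| <= e.
    rewrite -ler_pdivlMl ?ltr_wpDl//.
    near: h; apply: dnbhs0_le; rewrite mulr_gt0// invr_gt0 ltr_wpDl//.
  rewrite /= /GRing.scale/= mulr1 (addrC h x).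
  have -> : l - h^-1 * (f (x + h) - f x) = - (h^-1 * (f (x + h) - f x - l * h)).
    by field.
  rewrite normrN normrM normfV ler_pdivrMl ?normr_gt0//.
  apply: le_trans (fC h) _; rewrite -real_normK ?num_real// expr2.
  rewrite mulrA mulrC ler_wpM2l//.
  by apply: le_trans he; rewrite ler_wpM2r// lerDl.
by apply: DeriveDef; [apply/cvg_ex; exists l | exact/cvg_lim].
Unshelve. all: by end_near. Qed.

(** The simplest function of class C^1 that vanishes on a half-line. *)
Definition possq (t : R) : R := Num.max 0 t ^+ 2.

Lemma is_derive_possq (t : R) : is_derive t 1 possq (2 * Num.max 0 t).
Proof.
apply: (@is_derive_quadratic _ _ _ 1) => h; rewrite /possq.
rewrite !maxEle; case: (leP 0 t) => t0; case: (leP 0 (t + h)) => th;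
  rewrite ler_norml; apply/andP; split; nra.
Qed.

Lemma continuous_max0 : continuous (fun t : R => Num.max 0 t).
Proof. by move=> t; apply: continuous_max; [exact: cvg_cst | exact: cvg_id]. Qed.

Lemma is_derive_continuous f (x l : R) : is_derive x 1 f l -> {for x, continuous f}.
Proof. by move=> [fx _]; apply/differentiable_continuous/derivable1_diffP. Qed.

Lemma derive1_is_derive f (x l : R) : is_derive x 1 f l -> derive1 f x = l.
Proof. by move=> [_ <-]; rewrite derive1E. Qed.

Lemma is_derive_possq_comp (q : R -> R) (x l : R) : is_derive x 1 q l ->
  is_derive x 1 (possq \o q) (2 * Num.max 0 (q x) * l).
Proof. by move=> ql; apply: is_derive1_comp; exact: is_derive_possq. Qed.

(** Positive exactly on the open interval between a and b when a <= b, so that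
    composing it with [possq] gives a C^1 bump supported there. *)
Definition hump (a b x : R) : R := (x - a) * (b - x).

Lemma is_derive_hump (a b x : R) : is_derive x 1 (hump a b) (a + b - 2 * x).
Proof.
apply: (@is_derive_quadratic _ _ _ 1) => h; rewrite /hump.
rewrite (_ : _ - _ - _ = - h ^+ 2); last by ring.
by rewrite normrN ger0_norm ?sqr_ge0// mul1r.
Qed.

Lemma hump_le0 (a b x : R) : a <= b -> (x <= a) || (b <= x) -> hump a b x <= 0.
Proof. by rewrite /hump => ab /orP[] ?; nra. Qed.

Lemma hump_gt0 (a b x : R) : a < x < b -> 0 < hump a b x.
Proof. by rewrite /hump => /andP[? ?]; nra. Qed.

Lemma possq_le0 (t : R) : t <= 0 -> possq t = 0.
Proof. by rewrite /possq => t0; rewrite max_l// expr0n. Qed.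

Lemma possq_gt0 (t : R) : 0 < t -> 0 < possq t.
Proof. by rewrite /possq => t0; rewrite max_r ?exprn_gt0// ltW. Qed.

Lemma possq_ge0 (t : R) : 0 <= possq t.
Proof. exact: sqr_ge0. Qed.

(** The map s |-> n s / (1 + n s) sends 0 to 0 and tends to 1 for s > 0; applied
    to a bump it gives C^1 functions with values in [0, 1] that increase to the
    indicator function of the open interval. *)
Definition plateau (a b : R) (n : nat) (x : R) : R :=
  n%:R * possq (hump a b x) / (1 + n%:R * possq (hump a b x)).

Lemma plateau_den_gt0 (a b : R) n x : 0 < 1 + n%:R * possq (hump a b x).
Proof. by rewrite ltr_pwDl// mulr_ge0// possq_ge0. Qed.

Lemma plateau_ge0 (a b : R) n x : 0 <= plateau a b n x.
Proof.
apply: divr_ge0; last exact: ltW (plateau_den_gt0 _ _ _ _).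
by apply: mulr_ge0 => //; exact: possq_ge0.
Qed.

Lemma plateau_le1 (a b : R) n x : plateau a b n x <= 1.
Proof. by rewrite ler_pdivrMr ?plateau_den_gt0// mul1r lerDr. Qed.

Lemma plateau_out (a b : R) n x : a <= b -> (x <= a) || (b <= x) ->
  plateau a b n x = 0.
Proof. by move=> ab xab; rewrite /plateau possq_le0 ?hump_le0// mulr0 mul0r. Qed.

Lemma cvg_plateau (a b x : R) : a < x < b -> plateau a b ^~ x @ \oo --> (1 : R).
Proof.
move=> xab; have p0 := possq_gt0 (hump_gt0 xab).
apply/cvgrPdist_le => e e0.
have e1 : 0 < (possq (hump a b x) * e)^-1 by rewrite invr_gt0 mulr_gt0.
near=> n.
have nN : (possq (hump a b x) * e)^-1 <= n%:R by near: n; exact: nbhs_infty_ger.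
have d0 := plateau_den_gt0 a b n x.
move: p0 e1 nN d0; rewrite /plateau; move: (possq (hump a b x)) => p p0 e1 nN d0.
have -> : 1 - n%:R * p / (1 + n%:R * p) =
    (1 + n%:R * p)^-1 by field; rewrite gt_eqF.
rewrite ger0_norm; last by rewrite invr_ge0 ltW.
rewrite -div1r ler_pdivrMr//.
move: nN; rewrite -div1r ler_pdivrMr ?mulr_gt0// => nN.
have -> : e * (1 + n%:R * p) = e + n%:R * (p * e).
  by ring.
lra.
Unshelve. all: by end_near. Qed.

Lemma is_derive_plateau (a b : R) (n : nat) (x : R) : is_derive x 1 (plateau a b n)
  ((1 + n%:R * possq (hump a b x)) ^- 2 *
    (n%:R * (2 * Num.max 0 (hump a b x) * (a + b - 2 * x)))).
Proof.
have d0 := plateau_den_gt0 a b n.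
have -> : plateau a b n = fun y => 1 - (1 + n%:R * possq (hump a b y))^-1.
  by apply/funext => y; rewrite /plateau; field; rewrite gt_eqF.
have Hh := is_derive_possq_comp (is_derive_hump a b x).
set l := 2 * _ * _ in Hh *.
have HD : is_derive x 1 (fun y => 1 + n%:R * possq (hump a b y)) (0 + n%:R * l).
  exact: (is_deriveD (is_derive_cst (1 : R) x 1) (is_deriveZ n%:R Hh)).
have HV := @is_deriveV R (fun y => 1 + n%:R * possq (hump a b y)) x _ 1
  (lt0r_neq0 (d0 x)) HD.
have HB := is_deriveB (is_derive_cst (1 : R) x 1) HV.
apply: (is_derive_eq HB).
by rewrite /GRing.scale/= add0r mulNr; ring.
Qed.

Lemma continuous_hump (a b : R) : continuous (hump a b).
Proof. by move=> x; apply: is_derive_continuous; exact: is_derive_hump. Qed.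

Lemma continuous_possq : continuous (@possq).
Proof. by move=> x; apply: is_derive_continuous; exact: is_derive_possq. Qed.

Lemma test_function_plateau (a b : R) n : a <= b -> test_function (plateau a b n).
Proof.
move=> ab; split.
- by move=> x; case: (is_derive_plateau a b n x).
- have -> : derive1 (plateau a b n) = fun x => (1 + n%:R * possq (hump a b x)) ^- 2 *
    (n%:R * (2 * Num.max 0 (hump a b x) * (a + b - 2 * x))).
    by apply/funext => x; exact: derive1_is_derive (is_derive_plateau a b n x).
  move=> x; apply: cvgM.
    apply: cvgV; first by rewrite lt0r_neq0// exprn_gt0// plateau_den_gt0.
    have cd : {for x, continuous (fun x => 1 + n%:R * possq (hump a b x))}.
      apply: cvgD; first exact: cvg_cst.
      apply: cvgM; first exact: cvg_cst.
      apply: continuous_comp; [exact: continuous_hump|exact: continuous_possq].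
    exact: (cvg_comp _ _ cd (@exprn_continuous R 2 _)).
  apply: cvgM; first exact: cvg_cst.
  apply: cvgM; last first.
    apply: cvgB; first exact: cvg_cst.
    by apply: cvgM; [exact: cvg_cst|exact: cvg_id].
  apply: cvgM; first exact: cvg_cst.
  apply: (@continuous_comp _ _ _ (hump a b) (fun t : R => Num.max 0 t)).
    exact: continuous_hump.
  exact: continuous_max0.
- exists (`|a| + `|b|) => x xM; apply: plateau_out => //.
  apply: contraLR xM; rewrite negb_or -!ltNge -leNgt => /andP[ax xb].
  rewrite ler_norml; apply/andP; split.
    by rewrite lerNl; have := ler_norm (- a); rewrite normrN; have := normr_ge0 b; lra.
  by have := ler_norm b; have := normr_ge0 a; lra.
Qed.

End Bump.

(** * The fundamental lemma of the calculus of variations *)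

Section WeakDerivatives.
Context {R : realType}.
Local Notation mu := (@lebesgue_measure R).
Implicit Types (f g u v w k phi : R -> R).

Definition bounded_support k := exists M : R, forall x : R, M < `|x| -> k x = 0.

Lemma integrable_restrict_itv w (i : interval R) :
  mu.-integrable [set` i] (EFin \o w) ->
  mu.-integrable setT (EFin \o (w \_ [set` i])).
Proof.
move=> iw; rewrite -restrict_EFin.
by apply/integrable_restrict => //=; rewrite setTI.
Qed.

Lemma locally_integrable_itv w (a b : R) : locally_integrable setT w ->
  mu.-integrable `[a, b] (EFin \o w).
Proof.
move=> [mw _ wK]; apply/integrableP; split.
  by apply/measurable_EFinP; exact: measurable_funTS.
by apply: wK => //; exact: segment_compact.
Qed.

Lemma continuous_bounded_itv k (a b : R) : continuous k ->
  [bounded k x | x in `[a, b]%classic].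
Proof.
move=> ck.
have : compact (k @` `[a, b]).
  apply: continuous_compact; last exact: segment_compact.
  by apply: continuous_subspaceT.
move=> /compact_bounded[M [Mr kM]]; exists M; split => // y My x /= xab.
by apply: kM => //; exists x.
Qed.

Lemma mul_bounded_supportE w k (M : R) : (forall x, M < `|x| -> k x = 0) ->
  (fun x => w x * k x) = (fun x => w x * k x) \_ `[- M, M].
Proof.
move=> kM; apply/funext => x; rewrite patchE; case: ifPn => //.
rewrite notin_setE/= in_itv/= -ler_norml => /negP; rewrite -ltNge => /kM ->.
by rewrite mulr0.
Qed.

Lemma integrable_mul_bounded_support w k : locally_integrable setT w ->
  continuous k -> bounded_support k ->
  mu.-integrable setT (EFin \o (fun x => w x * k x)).
Proof.
move=> lw ck [M kM].
rewrite (mul_bounded_supportE w kM); apply: integrable_restrict_itv.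
have -> : EFin \o (fun x => w x * k x) = ((EFin \o w) \* (EFin \o k))%E.
  by apply/funext => x; rewrite /= EFinM.
apply: integrableMl => //.
- exact: locally_integrable_itv.
- by apply: measurable_funTS; exact: continuous_measurable_fun.
- exact: continuous_bounded_itv.
Qed.

Lemma test_function_continuous phi : test_function phi -> continuous phi.
Proof. by move=> [d _ _] x; apply/differentiable_continuous/derivable1_diffP. Qed.

Lemma derive1_out phi (M : R) : (forall x : R, M < `|x| -> phi x = 0) ->
  forall x : R, M < `|x| -> derive1 phi x = 0.
Proof.
move=> phiM x Mx; rewrite derive1E.
rewrite (@near_eq_derive _ _ _ _ (cst 0)); first by rewrite derive_cst.
have := @norm_continuous R _ x.
move=> /(@cvgr_gt _ _ _ _ _ _) /(_ _ Mx).
by apply: filterS => y; exact: phiM.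
Qed.

Lemma Rintegral_mul_bounded_support w k (M : R) : (forall x, M < `|x| -> k x = 0) ->
  \int[mu]_x (w x * k x) = \int[mu]_(x in `[- M, M]) (w x * k x).
Proof. by move=> kM; rewrite [RHS]Rintegral_mkcond -(mul_bounded_supportE w kM). Qed.

Lemma Rintegral_derive1 f (a b : R) : a <= b ->
  (forall x, derivable f x 1) -> continuous (derive1 f) ->
  \int[mu]_(x in `[a, b]) derive1 f x = f b - f a.
Proof.
rewrite le_eqVlt => /predU1P[->|ab] df cf.
  by rewrite set_itv1 Rintegral_set1 subrr.
have cF x : {for x, continuous f} by apply/differentiable_continuous/derivable1_diffP.
have /(@continuous_FTC2 _ _ f _ _ ab) : {within `[a, b], continuous (derive1 f)}.
  exact: continuous_subspaceT.
rewrite /Rintegral => -> //.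
by split => //; [apply: cvg_at_right_filter|apply: cvg_at_left_filter]; exact: cF.
Qed.

Lemma locally_integrable_cst (c : R) : locally_integrable setT (cst c).
Proof.
split => //; first exact: openT.
move=> K _ cK; under eq_integral do rewrite /=.
rewrite (@integral_cst _ _ _ mu K (compact_measurable cK)).
by rewrite lte_mul_pinfty// compact_finite_measure.
Qed.

(** Testing against the plateau functions and passing to the limit by dominated
    convergence. *)
Lemma fundamental_lemma_itv w (a b : R) : locally_integrable setT w ->
  (forall phi, test_function phi -> \int[mu]_x (w x * phi x) = 0) ->
  a <= b -> \int[mu]_(x in `[a, b]) w x = 0.
Proof.
move=> lw w0 ab.
have mw : measurable_fun setT w by case: lw.
have tp n := test_function_plateau n ab.
have mp n : measurable_fun setT (plateau a b n).
  by apply: continuous_measurable_fun; exact: test_function_continuous.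
have bs n : bounded_support (plateau a b n) by case: (tp n).
have ip n := integrable_mul_bounded_support lw (test_function_continuous (tp n)) (bs n).
have cv x : w x * plateau a b n x @[n --> \oo] --> (w \_ `]a, b[) x.
  rewrite patchE; case: ifPn => [|].
    rewrite inE/= in_itv/= => xab.
    rewrite -[X in _ --> X]mulr1; apply: cvgM; first exact: cvg_cst.
    exact: cvg_plateau.
  rewrite notin_setE/= in_itv/= => /negP; rewrite negb_and -!leNgt => xab.
  under eq_fun do rewrite plateau_out// mulr0.
  exact: cvg_cst.
have ig : mu.-integrable setT (EFin \o ((Num.norm \o w) \_ `[a, b])).
  apply: integrable_restrict_itv.
  exact: (integrable_norm (locally_integrable_itv a b lw)).
have le1 n x : `|w x * plateau a b n x| <= ((Num.norm \o w) \_ `[a, b]) x.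
  rewrite patchE normrM (ger0_norm (plateau_ge0 _ _ _ _)).
  case: ifPn => [_|]; first by rewrite ler_piMr// plateau_le1.
  rewrite notin_setE/= in_itv/= => /negP; rewrite negb_and -!ltNge => xab.
  by rewrite plateau_out ?mulr0//; case/orP: xab => /ltW ->; rewrite ?orbT.
have mw1 : measurable_fun setT (w \_ `]a, b[).
  by apply: (measurable_restrict _ _ _).1 => //; exact: measurable_funTS.
have mwp n : measurable_fun setT (fun x => w x * plateau a b n x).
  exact: measurable_funM.
have := @Rintegral_dominated_cvg _ _ _ mu _ _ _ mwp mw1 cv ig le1.
under eq_fun do rewrite w0//.
move=> /(cvg_unique _ (cvg_cst _)) => H.
have iab : mu.-integrable `[a, b] (EFin \o w) by exact: locally_integrable_itv.
have iab1 : mu.-integrable `[a, b[ (EFin \o w).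
  by apply: integrableS iab => // x /=; rewrite !in_itv/= => /andP[-> /ltW].
have iab2 : mu.-integrable `]a, b[ (EFin \o w).
  by apply: integrableS iab => //; exact: subset_itv_oo_cc.
rewrite -Rintegral_itv_bndo_bndc// -Rintegral_itv_obnd_cbnd//.
by rewrite Rintegral_mkcond -H.
Qed.

Lemma fundamental_lemma w : locally_integrable setT w ->
  (forall phi, test_function phi -> \int[mu]_x (w x * phi x) = 0) ->
  {ae mu, forall x, w x = 0}.
Proof.
move=> lw w0.
(* The primitive of w with base point -n is identically 0, and its derivative
   is w almost everywhere to the right of -n. *)
have ae_n (n : nat) : {ae mu, forall x, - n%:R < x -> w x = 0}.
  have iw y : mu.-integrable [set` Interval (BLeft (- n%:R)) (BRight y)] (EFin \o w).
    exact: locally_integrable_itv.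
  have := FTC1 iw lw.
  apply: ae_imp.
  move=> x H nx.
  have nxE : ((- n%:R)%:E < x%:E)%E by rewrite lte_fin.
  have [_ <-] := H nxE.
  rewrite (_ : (fun _ => _) = cst 0); first by rewrite derive1_cst.
  apply/funext => y; have [ny|yn] := leP (- n%:R) y.
    exact: fundamental_lemma_itv.
  by rewrite set_itv_ge ?Rintegral_set0// bnd_simp -ltNge.
have := ae_foralln ae_n.
apply: ae_imp.
move=> x /(_ (Num.trunc `|x|).+1); apply.
rewrite ltrNl; apply: (@le_lt_trans _ _ `|x|); first by rewrite -normrN ler_norm.
exact: truncnS_gt.
Qed.

(** The energy of a function is defined through a choice among its weak
    derivatives; this makes its value independent of the choice. *)
Lemma weak_derivative_unique u g h : is_weak_derivative u g -> is_weak_derivative u h ->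
  {ae mu, forall x, g x = h x}.
Proof.
move=> [_ lg ug] [_ lh uh].
have : {ae mu, forall x, g x - h x = 0}.
  apply: fundamental_lemma; first exact: locally_integrableB.
  move=> phi tphi; have [_ _ sphi] := tphi.
  have cphi := test_function_continuous tphi.
  under eq_Rintegral do rewrite mulrBl.
  rewrite RintegralB//; [|exact: integrable_mul_bounded_support..].
  apply/eqP; rewrite subr_eq0 -(inj_eq oppr_inj).
  by rewrite -ug// -uh.
apply: ae_imp.
by move=> x /eqP; rewrite subr_eq0 => /eqP.
Qed.

End WeakDerivatives.

(** * Primitives of square integrable functions *)

Section L2Primitives.
Context {R : realType}.
Local Notation mu := (@lebesgue_measure R).
Implicit Types (f g u v w k phi : R -> R).

(** The pair consists of the continuous representative of a function with a
    square integrable weak derivative and of a version of that derivative.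
    Keeping both, instead of deriving one from the other, turns linear
    combinations and limits into statements about integrals only. *)
Definition is_L2_primitive v g := [/\ measurable_fun setT g, (sqint mu g < +oo)%E
  & forall x y, x <= y -> v y - v x = \int[mu]_(t in `[x, y]) g t].

Lemma L2_integrable_sq g : measurable_fun setT g -> (sqint mu g < +oo)%E ->
  mu.-integrable setT (EFin \o (fun x => g x ^+ 2)).
Proof.
move=> mg gfin; apply/integrableP; split.
  by apply/measurable_EFinP; exact: measurable_funX.
under eq_integral do rewrite /= ger0_norm ?sqr_ge0//.
exact: gfin.
Qed.

Lemma L2_locally_integrable g : measurable_fun setT g -> (sqint mu g < +oo)%E ->
  locally_integrable setT g.
Proof.
move=> mg gfin; split => //; first exact: openT.
move=> K _ cK; have mK : measurable K by exact: compact_measurable.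
have i1 : mu.-integrable K (EFin \o (fun x => 1 + g x ^+ 2)).
  apply: integrableRD => //; last by apply: integrableS (L2_integrable_sq mg gfin).
  have [mc _ ic] := locally_integrable_cst (1 : R).
  apply/integrableP; split; last exact: ic.
  by apply/measurable_EFinP; exact: measurable_funTS.
have : mu.-integrable K (EFin \o g).
  apply: le_integrable i1 => //.
    by apply/measurable_EFinP; exact: measurable_funTS.
  move=> x _; rewrite /= lee_fin (@ger0_norm _ (1 + g x ^+ 2)); last by rewrite addr_ge0// sqr_ge0.
  by rewrite -real_normK ?num_real//; have := normr_ge0 (g x); nra.
by case/integrableP.
Qed.

Lemma Rintegral_sq_itv_le g x y : measurable_fun setT g -> (sqint mu g < +oo)%E ->
  \int[mu]_(t in `[x, y]) (g t ^+ 2) <= fine (sqint mu g).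
Proof.
move=> mg gfin; apply: fine_le.
- apply: integrable_fin_num => //.
  by apply: integrableS (L2_integrable_sq mg gfin).
- by rewrite ge0_fin_numE// sqint_ge0.
- apply: ge0_subset_integral => //; first exact: measurable_sqE.
  by move=> t _; rewrite lee_fin sqr_ge0.
Qed.

(** The variance of g on the interval, that is the integral of the square of
    the difference between g and its mean, is nonnegative. *)
Lemma cauchy_schwarz_itv g x y : measurable_fun setT g -> (sqint mu g < +oo)%E ->
  x <= y -> (\int[mu]_(t in `[x, y]) g t) ^+ 2 <= (y - x) * fine (sqint mu g).
Proof.
move=> mg gfin; rewrite le_eqVlt => /predU1P[->|xy].
  by rewrite set_itv1 Rintegral_set1 expr0n/= subrr mul0r.
have L0 : 0 < y - x by rewrite subr_gt0.
have := Rintegral_sq_itv_le x y mg gfin.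
have ig : mu.-integrable `[x, y] (EFin \o g).
  by apply: locally_integrable_itv; exact: L2_locally_integrable.
have ig2 : mu.-integrable `[x, y] (EFin \o (fun x => g x ^+ 2)).
  by apply: integrableS (L2_integrable_sq mg gfin).
set I := \int[mu]_(t in _) g t; set S := fine _ => HS.
(* The mean of g on the interval. *)
pose c := I / (y - x).
have icst (e : R) : mu.-integrable `[x, y] (EFin \o cst e).
  by apply: locally_integrable_itv; exact: locally_integrable_cst.
have icg : mu.-integrable `[x, y] (EFin \o (fun t => (2 * c) * g t)).
  exact: integrableRZ.
have : 0 <= \int[mu]_(t in `[x, y]) ((g t - c) ^+ 2).
  by apply: Rintegral_ge0 => t _; exact: sqr_ge0.
have -> : \int[mu]_(t in `[x, y]) ((g t - c) ^+ 2) =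
  \int[mu]_(t in `[x, y]) (g t ^+ 2 - (2 * c) * g t + c ^+ 2).
  by apply: eq_Rintegral => t _; ring.
rewrite RintegralD; [|by []|exact: integrableRB|exact: icst].
rewrite RintegralB// RintegralZl// Rintegral_cst//.
have -> : fine (mu `[x, y]%classic) = y - x.
  by rewrite lebesgue_measure_itv/= lte_fin xy.
rewrite -/I.
have -> : 2 * c * I = 2 * (I ^+ 2 / (y - x)) by rewrite /c; field; rewrite gt_eqF.
have -> : c ^+ 2 * (y - x) = I ^+ 2 / (y - x) by rewrite /c; field; rewrite gt_eqF.
move=> H; rewrite -ler_pdivrMl// mulrC.
by move: (I ^+ 2 / (y - x)) H HS => a; lra.
Qed.

Lemma L2_primitive_hoelder_half v g x y : is_L2_primitive v g ->
  (v y - v x) ^+ 2 <= `|y - x| * fine (sqint mu g).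
Proof.
move=> [mg gfin vg]; case: (leP x y) => xy.
  by rewrite vg// ger0_norm ?subr_ge0//; exact: cauchy_schwarz_itv.
have yx := ltW xy; rewrite -sqrrN opprB vg// distrC ger0_norm ?subr_ge0//.
exact: cauchy_schwarz_itv.
Qed.

Lemma L2_primitive_continuous v g : is_L2_primitive v g -> continuous v.
Proof.
move=> vg x; apply/cvgrPdist_le => /= e e0.
set S := fine (sqint mu g).
have S0 : 0 <= S by rewrite fine_ge0// sqint_ge0.
near=> y.
have H := L2_primitive_hoelder_half y x vg.
have d : `|x - y| * (S + 1) <= e ^+ 2.
  rewrite -ler_pdivlMr ?ltr_wpDl//.
  near: y; apply: (@cvgr_dist_le _ _ _ (nbhs x) _ id x) => //.
  by rewrite divr_gt0 ?exprn_gt0// ltr_wpDl.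
have e2 : `|v x - v y| ^+ 2 <= e ^+ 2.
  rewrite real_normK ?num_real//; apply: le_trans H _; apply: le_trans d.
  by rewrite ler_wpM2l// lerDl.
by move: e2; rewrite ler_pXn2r// nnegrE ltW.
Unshelve. all: by end_near. Qed.

Lemma L2_primitiveD v g w h : is_L2_primitive v g -> is_L2_primitive w h ->
  is_L2_primitive (fun x => v x + w x) (fun x => g x + h x).
Proof.
move=> [mg gfin vg] [mh hfin wh]; have mgh := measurable_funD mg mh.
have lg := L2_locally_integrable mg gfin; have lh := L2_locally_integrable mh hfin.
split => //.
- have := sqint_parallelogram mu mg mh.
  have := sqint_ge0 mu (g \+ h)%R; have := sqint_ge0 mu (g \- h)%R.
  have : (2%:E * sqint mu g + 2%:E * sqint mu h < +oo)%E.
    by apply: lte_add_pinfty; apply: lte_mul_pinfty.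
  rewrite (_ : (fun x => g x + h x) = g \+ h)//.
  by move=> H1 H2 H3 H4; apply: le_lt_trans H1; rewrite -H4; exact: leeDl.
- move=> x y xy.
  rewrite RintegralD//; try exact: locally_integrable_itv.
  by rewrite -vg// -wh//; ring.
Qed.

Lemma L2_primitiveZ v g (c : R) : is_L2_primitive v g ->
  is_L2_primitive (fun x => c * v x) (fun x => c * g x).
Proof.
move=> [mg gfin vg]; split; first exact: measurable_funM.
- by rewrite sqintZ// lte_mul_pinfty// lee_fin sqr_ge0.
- move=> x y xy; rewrite RintegralZl// -?vg// ?mulrBr//.
  by apply: locally_integrable_itv; exact: L2_locally_integrable.
Qed.

End L2Primitives.

(** * Weakly differentiable functions are primitives *)

Section L2Representatives.
Context {R : realType}.
Local Notation mu := (@lebesgue_measure R).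
Implicit Types (f g u v w k phi : R -> R).

Lemma continuous_locally_integrable v : continuous v -> locally_integrable setT v.
Proof.
move=> cv; split; [exact: continuous_measurable_fun | exact: openT |].
move=> K _ cK; have := @continuous_compact_integrable R v K cK (continuous_subspaceT cv).
by case/integrableP.
Qed.

Lemma integrable_bounded_support k : continuous k -> bounded_support k ->
  mu.-integrable setT (EFin \o k).
Proof.
move=> ck sk.
have := integrable_mul_bounded_support (locally_integrable_cst (1 : R)) ck sk.
by rewrite (_ : (fun x => cst 1 x * k x) = k)//; apply/funext => x; rewrite mul1r.
Qed.

Lemma measurable_le_kernel :
  measurable_fun setT (fun z : R * R => ((z.2 <= z.1)%R)%:R : R).
Proof.
have mb : measurable_fun setT (fun b : bool => b%:R : R) by [].
apply: (measurableT_comp mb).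
by apply: measurable_fun_ler; [exact: measurable_snd|exact: measurable_fst].
Qed.

Lemma Rintegral_derive1_test phi : test_function phi ->
  \int[mu]_x derive1 phi x = 0.
Proof.
move=> tphi; have [dphi cdphi [M0 M0phi]] := tphi.
pose M := `|M0| + 1.
have lt0 : M0 < M by rewrite /M; have := ler_norm M0; lra.
have M0' : 0 < M by rewrite /M; have := normr_ge0 M0; lra.
have phiM : phi M = 0 by apply: M0phi; rewrite ger0_norm ?ltW.
have phiNM : phi (- M) = 0 by apply: M0phi; rewrite normrN ger0_norm ?ltW.
have out x : M < `|x| -> derive1 phi x = 0.
  by move=> Mx; apply: (derive1_out M0phi); exact: lt_trans Mx.
have := Rintegral_mul_bounded_support (cst 1) out.
under eq_Rintegral do rewrite mul1r.
under [in X in _ = X]eq_Rintegral do rewrite mul1r.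
have NMM : - M <= M by lra.
by move=> ->; rewrite (Rintegral_derive1 NMM dphi cdphi) phiM phiNM subrr.
Qed.

(** Integration by parts.  On the support of phi, v is a constant plus the
    integral of g over an interval with moving endpoint; exchanging the order
    of integration moves the integral onto the derivative of phi. *)
Lemma L2_primitive_weak_derivative v g : is_L2_primitive v g -> is_weak_derivative v g.
Proof.
move=> vg; have [mg gfin vgE] := vg.
have cv := L2_primitive_continuous vg.
have lv := continuous_locally_integrable cv.
have lg := L2_locally_integrable mg gfin.
split => // phi tphi; have [dphi cdphi [M0 M0phi]] := tphi.
pose M := `|M0| + 1.
have lt0 : M0 < M by rewrite /M; have := ler_norm M0; lra.
have M0' : 0 < M by rewrite /M; have := normr_ge0 M0; lra.
have phi_out x : M <= `|x| -> phi x = 0.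
  by move=> Mx; apply: M0phi; exact: lt_le_trans Mx.
have dphi_out x : M < `|x| -> derive1 phi x = 0.
  by move=> Mx; apply: (derive1_out M0phi); exact: lt_trans Mx.
have phiM : phi M = 0 by apply: phi_out; rewrite ger0_norm// ltW.
(* K couples the variable x of phi with the variable t of g: the increment of v
   from -M to x is the integral of K (x, t) p t over t. *)
pose K (z : R * R) : R := ((z.2 <= z.1)%R)%:R.
pose p := g \_ `[- M, M].
have ip : mu.-integrable setT (EFin \o p).
  by apply: integrable_restrict_itv; exact: locally_integrable_itv.
have sd : bounded_support (derive1 phi) by exists M.
have iq := integrable_bounded_support cdphi sd.
have K1 z : `|K z| <= 1 by rewrite /K; case: (leP z.2 z.1) => _; rewrite ?normr1 ?normr0.
have innerE x : derive1 phi x * \int[mu]_t (K (x, t) * p t) =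
    v x * derive1 phi x - v (- M) * derive1 phi x.
  have [xM|Mx] := leP `|x| M; last by rewrite dphi_out// !mulr0 mul0r subrr.
  move: xM; rewrite ler_norml => /andP[Mx xM].
  rewrite -mulrBl vgE// mulrC; congr (_ * _).
  rewrite [RHS]Rintegral_mkcond; apply: eq_Rintegral => t _.
  rewrite /K /p !patchE /= !mem_setE !in_itv/=.
  case: (leP (- M) t) => /= Mt; last by rewrite mulr0.
  case: (leP t x) => tx; last by rewrite mul0r.
  by rewrite (le_trans tx xM) mul1r.
have outerE t : p t * \int[mu]_x (K (x, t) * derive1 phi x) = - (g t * phi t).
  rewrite /p patchE mem_setE in_itv/= -ler_norml.
  case: (leP `|t| M) => tM; last by rewrite mul0r phi_out ?mulr0 ?oppr0// ltW.
  rewrite -mulrN; congr (_ * _).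
  have {}tM : t <= M by rewrite (le_trans (ler_norm t)).
  rewrite -[RHS]add0r -phiM -(Rintegral_derive1 tM dphi cdphi).
  rewrite [RHS]Rintegral_mkcond; apply: eq_Rintegral => x _.
  rewrite /K patchE mem_setE in_itv/=.
  case: (leP t x) => tx; last by rewrite mul0r.
  case: (leP x M) => xM; rewrite mul1r//=.
  by rewrite dphi_out// (lt_le_trans xM)// ler_norm.
have := @Rintegral_bounded_kernel _ _ _ _ R mu mu K (derive1 phi) p
  measurable_le_kernel K1 iq ip.
under eq_Rintegral do rewrite innerE.
under [in X in _ = X]eq_Rintegral do rewrite outerE.
have ivd : mu.-integrable setT (EFin \o (fun x => v x * derive1 phi x)).
  exact: integrable_mul_bounded_support.
rewrite RintegralB//; last exact: integrableRZ.
rewrite RintegralZl// Rintegral_derive1_test// mulr0 subr0 => ->.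
under eq_Rintegral do rewrite -mulN1r.
rewrite RintegralZl ?mulN1r//.
apply: integrable_mul_bounded_support => //.
  exact: test_function_continuous.
by exists M => x Mx; apply: phi_out; exact: ltW.
Qed.

(** The base point of the primitive is 0; half-open intervals make the
    additivity of the increments an identity between indicator functions. *)
Lemma L2_primitive_exists g : measurable_fun setT g -> (sqint mu g < +oo)%E ->
  exists v, is_L2_primitive v g.
Proof.
move=> mg gfin; have lg := L2_locally_integrable mg gfin.
have ir (a b : R) : mu.-integrable setT (EFin \o (g \_ `]a, b])).
  apply: integrable_restrict_itv; apply: integrableS (locally_integrable_itv a b lg) => //.
  exact: subset_itv_oc_cc.
exists (fun x => \int[mu]_t ((g \_ `]0, x]) t - (g \_ `]x, 0]) t)); split => // x y xy.
have ib z : mu.-integrable setT (EFin \o (fun t => (g \_ `]0, z]) t - (g \_ `]z, 0]) t)).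
  exact: integrableRB.
rewrite -RintegralB//.
rewrite -Rintegral_itv_obnd_cbnd; last first.
  by apply: integrableS (locally_integrable_itv x y lg) => //; exact: subset_itv_oc_cc.
rewrite [RHS]Rintegral_mkcond; apply: eq_Rintegral => t _.
have pE (A : set R) : (g \_ A) t = if t \in A then g t else 0 by rewrite patchE.
rewrite !pE !mem_setE !in_itv/=; move: (g t) => e.
case: (ltP 0 t) => t0; case: (ltP x t) => xt; case: (leP t y) => ty /=;
  rewrite ?subr0 ?subrr ?sub0r ?opprK//; lra.
Qed.

(** Otherwise the fundamental lemma, applied to the constant 1, would say that
    the interval [0, 1] has measure 0. *)
Lemma exists_test_mass : exists2 phi : R -> R, test_function phi & \int[mu]_x phi x != 0.
Proof.
apply: contrapT => H.
have all0 (phi : R -> R) : test_function phi -> \int[mu]_x (cst 1 x * phi x) = 0.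
  move=> tphi; apply: contrapT => /eqP nz; apply: H; exists phi => //.
  by move: nz; under eq_Rintegral do rewrite mul1r.
have := fundamental_lemma_itv (locally_integrable_cst (1 : R)) all0 ler01.
rewrite Rintegral_cst//.
have -> : fine (mu `[0, 1]%classic) = 1.
  by rewrite lebesgue_measure_itv/= lte_fin ltr01 oppr0 adde0.
by rewrite mulr1 => /eqP; rewrite oner_eq0.
Qed.

(** The primitive vanishes near minus infinity by construction and near plus
    infinity because the total integral is 0. *)
Lemma test_function_primitive k : continuous k -> bounded_support k ->
  \int[mu]_x k x = 0 -> exists2 phi, test_function phi & derive1 phi = k.
Proof.
move=> ck sk k0; have ik := integrable_bounded_support ck sk.
pose phi (x : R) := \int[mu]_(t in `]-oo, x]) k t.
have H x : derivable phi x 1 /\ derive1 phi x = k x.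
  apply: (@continuous_FTC1 R k -oo%O x (x + 1)) => //.
  - by rewrite ltrDl.
  - exact: integrableS ik.
  - by rewrite ltNyr.
  - exact: ck.
have dE : derive1 phi = k by apply/funext => x; case: (H x).
exists phi => //; split.
- by move=> x; case: (H x).
- by rewrite dE.
- have [M kM] := sk; exists `|M| => x Mx.
  have kM' t : `|M| < `|t| -> k t = 0.
    by move=> Mt; apply: kM; apply: le_lt_trans Mt; exact: ler_norm.
  rewrite /phi Rintegral_mkcond; have [x0|x0] := leP 0 x.
    rewrite -[RHS]k0; apply: eq_Rintegral => t _; rewrite patchE mem_setE in_itv/=.
    case: (leP t x) => // xt; rewrite kM'//.
    apply: lt_le_trans Mx _; rewrite ger0_norm//.
    exact: le_trans (ltW xt) (ler_norm t).
  rewrite -[RHS](Rintegral_set0 mu k) [RHS]Rintegral_mkcond; apply: eq_Rintegral => t _.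
  rewrite !patchE !mem_setE in_itv/= in_set0; case: (leP t x) => // tx.
  by apply: kM'; move: Mx; rewrite (ltr0_norm x0) (ltr0_norm (le_lt_trans tx x0)); lra.
Qed.

(** The lemma of du Bois-Reymond.  Subtracting from a test function psi a
    multiple of a fixed one with nonzero integral makes its integral vanish, so
    that it becomes a derivative; this shows that w minus a suitable constant is
    orthogonal to every psi. *)
Lemma weak_derivative0_cst w : locally_integrable setT w ->
  (forall phi, test_function phi -> \int[mu]_x (w x * derive1 phi x) = 0) ->
  exists c : R, {ae mu, forall x, w x = c}.
Proof.
move=> lw w0; have [eta teta eta0] := exists_test_mass.
have ceta := test_function_continuous teta; have [_ _ seta] := teta.
set m := \int[mu]_x eta x in eta0.
exists (\int[mu]_x (w x * eta x) / m).
set c := _ / _.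
have lwc : locally_integrable setT (fun x => w x - cst c x).
  by apply: locally_integrableB => //; exact: locally_integrable_cst.
have : {ae mu, forall x, w x - cst c x = 0}.
  apply: fundamental_lemma lwc _ => psi tpsi.
  have cpsi := test_function_continuous tpsi; have [_ _ spsi] := tpsi.
  have ipsi := integrable_bounded_support cpsi spsi.
  have ieta := integrable_bounded_support ceta seta.
  set s := \int[mu]_x psi x.
  have ck : continuous (fun x => psi x - s / m * eta x).
    move=> x; apply: cvgB; first exact: cpsi.
    by apply: cvgM; [exact: cvg_cst | exact: ceta].
  have sk : bounded_support (fun x => psi x - s / m * eta x).
    have [M1 h1] := spsi; have [M2 h2] := seta; exists (Num.max M1 M2) => x.
    by rewrite gt_max => /andP[/h1 -> /h2 ->]; rewrite mulr0 subrr.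
  have k0 : \int[mu]_x (psi x - s / m * eta x) = 0.
    rewrite RintegralB//; last exact: integrableRZ.
    by rewrite RintegralZl// -/m -/s divfK// subrr.
  have [phi tphi dphi] := test_function_primitive ck sk k0.
  have := w0 phi tphi; rewrite dphi.
  have iwpsi := integrable_mul_bounded_support lw cpsi spsi.
  have iweta := integrable_mul_bounded_support lw ceta seta.
  have -> : \int[mu]_x (w x * (psi x - s / m * eta x)) =
      \int[mu]_x (w x * psi x - s / m * (w x * eta x)).
    by apply: eq_Rintegral => x _; ring.
  rewrite RintegralB//; last exact: integrableRZ.
  rewrite RintegralZl// => H.
  have -> : \int[mu]_x ((w x - cst c x) * psi x) = \int[mu]_x (w x * psi x - c * psi x).
    by apply: eq_Rintegral => x _ /=; ring.
  rewrite RintegralB//; last exact: integrableRZ.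
  rewrite RintegralZl// -[RHS]H -/s /c; congr (_ - _).
  by field.
by apply: ae_imp => x /eqP; rewrite subr_eq0 => /eqP.
Qed.

(** The difference between u and a primitive of g has weak derivative 0. *)
Lemma L2_representative u g : is_weak_derivative u g -> (sqint mu g < +oo)%E ->
  exists2 v, is_L2_primitive v g & {ae mu, forall x, u x = v x}.
Proof.
move=> [lu lg ug] gfin; have mg : measurable_fun setT g by case: lg.
have [V Vg] := L2_primitive_exists mg gfin.
have [lV _ VgE] := L2_primitive_weak_derivative Vg.
have lw : locally_integrable setT (fun x => u x - V x) by exact: locally_integrableB.
have [|c uc] := weak_derivative0_cst lw.
  move=> phi tphi; have [_ cd [M phiM]] := tphi.
  have sd : bounded_support (derive1 phi) by exists M; exact: derive1_out.
  under eq_Rintegral do rewrite mulrBl.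
  rewrite RintegralB//; [|exact: integrable_mul_bounded_support..].
  by rewrite ug// VgE// subrr.
exists (fun x => V x + c).
  have [h1 h2 h3] := Vg; split => // x y xy.
  by rewrite -h3//; ring.
by apply: ae_imp uc => x /eqP; rewrite subr_eq addrC => /eqP.
Qed.

End L2Representatives.

(** * Compactness of bounded equicontinuous sequences *)

Section Compactness.
Context {R : realType}.
Local Notation mu := (@lebesgue_measure R).
Implicit Types (f g u v w k phi : R -> R).

(** By Tychonoff's theorem a bounded sequence of functions has a cluster point
    for pointwise convergence; only finitely many points are controlled at a
    time, which avoids a diagonal extraction. *)
Lemma pointwise_cluster (v : nat -> R -> R) (S : R) : (forall n x, `|v n x| <= S) ->
  exists u : R -> R, forall (m : nat) (pts : 'I_m -> R) (e : R) (N : nat), 0 < e ->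
    exists2 n, (N <= n)%N & forall i, `|v n (pts i) - u (pts i)| < e.
Proof.
move=> vS; pose P := prod_topology (fun _ : R => R : topologicalType).
have cP : compact [set f : P | forall x, `[- S, S]%classic (f x)].
  exact: (@tychonoff R (fun _ => R : topologicalType) (fun _ => `[- S, S]%classic)
    (fun _ => @segment_compact R (- S) S)).
pose F : set_system P := (v : nat -> P) @ \oo.
have FF : ProperFilter F by exact: fmap_proper_filter.
have FS : F [set f : P | forall x, `[- S, S]%classic (f x)].
  by exists 0%N => // n _ x; rewrite /= in_itv/= -ler_norml.
have [u [_ clu]] := cP F FF FS.
exists u => m pts e N e0.
have nbu : nbhs (u : P) [set f : P | forall i, `|f (pts i) - u (pts i)| < e].
  apply: (@filter_forall P 'I_m (fun i f => `|f (pts i) - u (pts i)| < e) (nbhs (u : P))) => i.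
  have H := @proj_continuous R (fun _ => R : topologicalType) (pts i) u.
  have Hb : nbhs (u : P) [set f : P | ball (u (pts i) : R) e (f (pts i) : R)].
    exact: H _ (nbhsx_ballx (u (pts i) : R) e e0).
  have sub : [set f : P | ball (u (pts i) : R) e (f (pts i) : R)] `<=`
      [set f : P | `|f (pts i) - u (pts i)| < e].
    by move=> f; rewrite /= -ball_normE /= distrC.
  exact: (filterS sub Hb).
have FN : F [set f : P | exists2 n, (N <= n)%N & f = v n].
  by exists N => // n /= Nn; exists n.
have [_ [[n Nn ->] H]] := clu _ _ FN nbu.
by exists n.
Qed.

Lemma cluster_modulus (v : nat -> R -> R) u :
  (forall (m : nat) (pts : 'I_m -> R) (e : R) (N : nat), 0 < e ->
    exists2 n, (N <= n)%N & forall i, `|v n (pts i) - u (pts i)| < e) ->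
  forall x y e, (forall n, `|v n x - v n y| <= e) -> `|u x - u y| <= e.
Proof.
move=> ucl x y e vxy; apply/ler_addgt0Pr => d d0.
have d2 : 0 < d / 2 by rewrite divr_gt0.
have [n _ H] := ucl 2 (fun i => if i == ord0 then x else y) (d / 2) 0%N d2.
have := H ord0; have := H ord_max; rewrite /= => Hy Hx; have := vxy n.
rewrite (_ : u x - u y = - (v n x - u x) + (v n x - v n y) + (v n y - u y)); last by ring.
have := ler_normD (- (v n x - u x) + (v n x - v n y)) (v n y - u y).
have := ler_normD (- (v n x - u x)) (v n x - v n y).
by rewrite normrN; move: Hx Hy; lra.
Qed.

(** Ascoli's theorem with an explicit modulus of continuity.  A grid that is fine
    enough for the common modulus reduces closeness on [-k, k] to closeness at
    finitely many points. *)
Lemma hoelder_precompact (v : nat -> R -> R) (A S : R) :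
  (forall n x, `|v n x| <= S) ->
  (forall n x y, (v n y - v n x) ^+ 2 <= `|y - x| * A) ->
  exists u : R -> R, forall k : nat, exists2 n, (k <= n)%N &
    forall x, `|x| <= k%:R -> `|v n x - u x| <= k.+1%:R^-1.
Proof.
move=> vS vA; have [u ucl] := pointwise_cluster vS.
exists u => k.
pose e : R := k.+1%:R^-1 / 3.
have e0 : 0 < e by rewrite divr_gt0// invr_gt0.
(* The mesh of the grid: over a distance d no function of the sequence varies
   by more than e. *)
pose d : R := e ^+ 2 / (`|A| + 1).
have A1 : 0 < `|A| + 1 by rewrite ltr_wpDl.
have d0 : 0 < d by rewrite divr_gt0// exprn_gt0.
have mod n x y : `|x - y| <= d -> `|v n x - v n y| <= e.
  move=> xyd; have : `|v n x - v n y| ^+ 2 <= e ^+ 2.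
    rewrite real_normK ?num_real//; apply: le_trans (vA n y x) _.
    apply: (@le_trans _ _ (d * (`|A| + 1))); last by rewrite divfK// gt_eqF.
    apply: (@le_trans _ _ (`|x - y| * (`|A| + 1))); last by rewrite ler_wpM2r// ltW.
    by rewrite ler_wpM2l//; have := ler_norm A; lra.
  by rewrite ler_pXn2r// nnegrE ltW.
pose m := (Num.truncn (2 * k%:R / d)).+1.
have [n kn H] := ucl m (fun i => - k%:R + i%:R * d) e k e0.
exists n => // x; rewrite ler_norml => /andP[kx xk].
have xk0 : 0 <= (x + k%:R) / d by apply: divr_ge0; [lra|exact: ltW].
have /andP[i1 i2] := truncn_itv xk0.
have im : (Num.truncn ((x + k%:R) / d) < m)%N.
  rewrite /m ltnS; apply: le_truncn; rewrite ler_pM2r ?invr_gt0//; lra.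
have := H (Ordinal im); rewrite /=.
set p := - k%:R + _ * d => Hp.
have xp : `|x - p| <= d.
  move: i1 i2; rewrite ler_pdivlMr// ltr_pdivrMr// -natr1 => i1 i2.
  rewrite /p ger0_norm; nra.
have h1 := mod n x p xp.
have h2 := cluster_modulus ucl (fun n => mod n x p xp).
rewrite (_ : v n x - u x = (v n x - v n p) + (v n p - u p) - (u x - u p)); last by ring.
have := ler_normB ((v n x - v n p) + (v n p - u p)) (u x - u p).
have := ler_normD (v n x - v n p) (v n p - u p).
have -> : k.+1%:R^-1 = e + e + e by rewrite /e; field.
move: Hp; lra.
Qed.

(** If |v| were larger than A + 3 at a point, it would be at least 2 on the unit
    interval to the right of it, and the mass would be at least 4. *)
Lemma L2_primitive_bounded v g (A x : R) : is_L2_primitive v g ->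
  (sqint mu v <= 1)%E -> fine (sqint mu g) <= A -> `|v x| <= A + 3.
Proof.
move=> vg v1 gA; rewrite leNgt; apply/negP => vx.
have A0 : 0 <= A by apply: le_trans gA; rewrite fine_ge0// sqint_ge0.
have v2 y : x <= y <= x + 1 -> 4 <= v y ^+ 2.
  move=> /andP[xy yx].
  have := L2_primitive_hoelder_half x y vg.
  rewrite ger0_norm ?subr_ge0// => H.
  have d1 : `|v y - v x| <= A + 1.
    have : `|v y - v x| ^+ 2 <= (A + 1) ^+ 2.
      rewrite real_normK ?num_real//; apply: le_trans H _.
      have := sqint_ge0 mu g => /fine_ge0; nra.
    by rewrite ler_pXn2r// nnegrE; lra.
  have := ler_normD (v y) (v x - v y); rewrite addrC subrK distrC => H2.
  have : 2 <= `|v y| by move: H2 d1 vx; lra.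
  by rewrite -(real_normK (num_real (v y))); move: `|v y| => t; nra.
have mv : measurable_fun setT v.
  by apply: continuous_measurable_fun; exact: L2_primitive_continuous vg.
have : (\int[mu]_(y in `[x, (x + 1)%R]) 4%:E <= sqint mu v)%E.
  apply: (@le_trans _ _ (\int[mu]_(y in `[x, (x + 1)%R]) (v y ^+ 2)%:E)%E).
    apply: ge0_le_integral => //.
    by apply/measurable_funTS; exact: measurable_sqE.
  apply: ge0_subset_integral => //; first exact: measurable_sqE.
  by move=> y _; rewrite lee_fin sqr_ge0.
move=> /le_trans/(_ v1).
rewrite (@integral_cst _ _ _ mu `[x, x + 1]%classic (measurable_itv _) 4%:E).
rewrite /= lebesgue_measure_itv/= lte_fin ltrDl ltr01 -EFinB addrAC subrr add0r.
by rewrite mule1 lee_fin; lra.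
Qed.

End Compactness.

(** * The Coulomb functional *)

Section Coulomb.
Context {R : realType}.
Local Notation mu := (@lebesgue_measure R).
Implicit Types (f g u v w k phi : R -> R).

Lemma G_ge0 (x y : R) : 0 <= G x y.
Proof. by rewrite /G mulr_ge0// subr_ge0 ler_normB. Qed.

Lemma G_le (M x y : R) : `|x| <= M -> G x y <= M.
Proof.
by rewrite /G => xM; have := ler_normD x (y - x); rewrite addrC subrK distrC; lra.
Qed.

Lemma G_ge (T x y : R) : (T <= x /\ T <= y) \/ (x <= - T /\ y <= - T) -> T <= G x y.
Proof.
have dE : `|x - y| = x - y \/ `|x - y| = y - x.
  case: (leP x y) => xy; [right; rewrite distrC|left];
    by rewrite ger0_norm// subr_ge0// ltW.
rewrite /G; have := ler_norm x; have := ler_norm y.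
have := ler_norm (- x); have := ler_norm (- y); rewrite !normrN.
by case: dE => -> ? ? ? ? -[|] []; lra.
Qed.

Lemma measurable_G : measurable_fun setT (fun p : R * R => G p.1 p.2).
Proof.
apply: measurable_funM => //; apply: measurable_funB; last first.
  by apply: measurableT_comp => //; apply: measurable_funB.
by apply: measurable_funD; apply: measurableT_comp.
Qed.

Definition coulomb_density f (p : R * R) : R := G p.1 p.2 * f p.1 * f p.2.

Lemma measurable_coulomb_density f : measurable_fun setT f ->
  measurable_fun setT (coulomb_density f).
Proof.
move=> mf; apply: measurable_funM; last exact: measurableT_comp.
by apply: measurable_funM; [exact: measurable_G | exact: measurableT_comp].
Qed.

Lemma coulomb_density_ge0 f p : (forall x, 0 <= f x) -> 0 <= coulomb_density f p.
Proof. by move=> f0; apply: mulr_ge0 => //; apply: mulr_ge0 => //; exact: G_ge0. Qed.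

Lemma coulomb_tonelli f : measurable_fun setT f -> (forall x, 0 <= f x) ->
  (coulomb f = \int[mu]_x \int[mu]_y (coulomb_density f (x, y))%:E)%E.
Proof.
move=> mf f0; rewrite /coulomb.
rewrite (@fubini_tonelli1 _ _ _ _ R mu mu (EFin \o coulomb_density f))//.
  by apply/measurable_EFinP; exact: measurable_coulomb_density.
by move=> p; rewrite /= lee_fin coulomb_density_ge0.
Qed.

Lemma measurable_coulomb_inner f : measurable_fun setT f -> (forall x, 0 <= f x) ->
  measurable_fun setT (fun x => (\int[mu]_y (coulomb_density f (x, y))%:E)%E).
Proof.
move=> mf f0.
apply: (@measurable_fun_fubini_tonelli_F _ _ _ _ R mu (EFin \o coulomb_density f)).
  by apply/measurable_EFinP; exact: measurable_coulomb_density.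
by move=> p; rewrite /= lee_fin coulomb_density_ge0.
Qed.

Lemma measurable_coulomb_section f x : measurable_fun setT f ->
  measurable_fun setT (fun y => (coulomb_density f (x, y))%:E).
Proof.
move=> mf; apply/measurable_EFinP.
exact: (measurableT_comp (measurable_coulomb_density mf) (measurable_pair1 _)).
Qed.

Lemma iterated_integral_product f (c : R) : measurable_fun setT f -> (forall x, 0 <= f x) ->
  0 <= c -> (\int[mu]_x \int[mu]_y (c * f x * f y)%:E =
    c%:E * (\int[mu]_x (f x)%:E * \int[mu]_x (f x)%:E))%E.
Proof.
move=> mf f0 c0; have mfE : measurable_fun setT (EFin \o f) by exact/measurable_EFinP.
have i0 : (0 <= \int[mu]_x (f x)%:E)%E by apply: integral_ge0 => x _; rewrite lee_fin.
under eq_integral => x _.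
  under eq_integral do rewrite EFinM.
  rewrite ge0_integralZl//; [|by move=> y _; rewrite lee_fin|by rewrite lee_fin mulr_ge0].
  rewrite EFinM -muleA (muleC (f x)%:E).
  over.
rewrite ge0_integralZl//.
- congr (_ * _)%E; rewrite ge0_integralZl//.
  by move=> x _; rewrite lee_fin.
- exact: measurable_funeM.
- by move=> x _; rewrite mule_ge0// lee_fin.
Qed.

Lemma coulomb_ae f g : measurable_fun setT f -> measurable_fun setT g ->
  (forall x, 0 <= f x) -> (forall x, 0 <= g x) ->
  {ae mu, forall x, f x = g x} -> coulomb f = coulomb g.
Proof.
move=> mf mg f0 g0 fg; rewrite !coulomb_tonelli//.
apply: ge0_ae_eq_integral => //.
- exact: measurable_coulomb_inner.
- exact: measurable_coulomb_inner.
- by move=> x _; apply: integral_ge0 => y _; rewrite lee_fin coulomb_density_ge0.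
- by move=> x _; apply: integral_ge0 => y _; rewrite lee_fin coulomb_density_ge0.
apply: ae_imp (fg) => x fgx _.
apply: ge0_ae_eq_integral => //.
- exact: measurable_coulomb_section.
- exact: measurable_coulomb_section.
- by move=> y _; rewrite lee_fin coulomb_density_ge0.
- by move=> y _; rewrite lee_fin coulomb_density_ge0.
apply: ae_imp fg => y fgy _.
by rewrite /coulomb_density/= fgx fgy.
Qed.

Lemma coulomb_ge0 f : (forall x, 0 <= f x) -> (0 <= coulomb f)%E.
Proof. by move=> f0; apply: integral_ge0 => p _; rewrite lee_fin coulomb_density_ge0. Qed.

(** The lower bound on the kernel over A x A decouples the double integral.
    This is the estimate that prevents the loss of mass at infinity. *)
Lemma coulomb_tail f (A : set R) (T : R) : measurable_fun setT f ->
  (forall x, 0 <= f x) -> measurable A -> 0 <= T ->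
  (forall x y, A x -> A y -> T <= G x y) ->
  (T%:E * (\int[mu]_(x in A) (f x)%:E * \int[mu]_(x in A) (f x)%:E) <= coulomb f)%E.
Proof.
move=> mf f0 mA T0 GT; rewrite coulomb_tonelli//.
have pE x : (f \_ A) x = if x \in A then f x else 0 by rewrite patchE.
have fA0 x : 0 <= (f \_ A) x by rewrite pE; case: ifP.
have mfA : measurable_fun setT (f \_ A).
  by apply: (measurable_restrict _ _ _).1 => //; exact: measurable_funTS.
have -> : (\int[mu]_(x in A) (f x)%:E = \int[mu]_x ((f \_ A) x)%:E)%E.
  by rewrite integral_mkcond; apply: eq_integral => x _; rewrite patchE pE; case: ifP.
rewrite -iterated_integral_product//.
apply: ge0_le_integral => //.
- by move=> x _; apply: integral_ge0 => y _; rewrite lee_fin !mulr_ge0.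
- apply: (@measurable_fun_fubini_tonelli_F _ _ _ _ R mu
    (fun p => (T * (f \_ A) p.1 * (f \_ A) p.2)%:E)).
    apply/measurable_EFinP; apply: measurable_funM; last exact: measurableT_comp.
    by apply: measurable_funM => //; exact: measurableT_comp.
  by move=> p; rewrite lee_fin !mulr_ge0.
- exact: measurable_coulomb_inner.
move=> x _; apply: ge0_le_integral => //.
- by move=> y _; rewrite lee_fin !mulr_ge0.
- by apply/measurable_EFinP; exact: measurable_funM.
- exact: measurable_coulomb_section.
move=> y _; rewrite lee_fin /coulomb_density/= !pE.
case: ifPn => xA; last by rewrite mulr0 mul0r (coulomb_density_ge0 (x, y) f0).
case: ifPn => yA; last by rewrite mulr0 (coulomb_density_ge0 (x, y) f0).
by rewrite ler_wpM2r// ler_wpM2r// GT//; rewrite -inE.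
Qed.

(** G x y never exceeds the absolute value of x. *)
Lemma coulomb_bounded_support f (M : R) : measurable_fun setT f ->
  (forall x, 0 <= f x) -> 0 <= M -> (forall x, M < `|x| -> f x = 0) ->
  (coulomb f <= M%:E * (\int[mu]_x (f x)%:E * \int[mu]_x (f x)%:E))%E.
Proof.
move=> mf f0 M0 fM; rewrite coulomb_tonelli// -iterated_integral_product//.
apply: ge0_le_integral => //.
- by move=> x _; apply: integral_ge0 => y _; rewrite lee_fin coulomb_density_ge0.
- exact: measurable_coulomb_inner.
- apply: (@measurable_fun_fubini_tonelli_F _ _ _ _ R mu
    (fun p => (M * f p.1 * f p.2)%:E)).
    apply/measurable_EFinP; apply: measurable_funM; last exact: measurableT_comp.
    by apply: measurable_funM => //; exact: measurableT_comp.
  by move=> p; rewrite lee_fin !mulr_ge0.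
move=> x _; apply: ge0_le_integral => //.
- by move=> y _; rewrite lee_fin coulomb_density_ge0.
- exact: measurable_coulomb_section.
- by apply/measurable_EFinP; exact: measurable_funM.
move=> y _; rewrite lee_fin /coulomb_density/=.
case: (leP `|x| M) => xM; last by rewrite fM// !mulr0 !mul0r.
by rewrite ler_wpM2r// ler_wpM2r// G_le.
Qed.

End Coulomb.

(** * Existence of a minimizer *)

Section Minimizer.
Context {R : realType}.
Local Notation mu := (@lebesgue_measure R).
Implicit Types (f g u v w phi : R -> R).

Lemma invS_le1 (k : nat) : (k.+1%:R^-1 : R) <= 1.
Proof. by rewrite invf_le1// ler1n. Qed.

Lemma invS_le (k l : nat) : (k <= l)%N -> (l.+1%:R^-1 : R) <= k.+1%:R^-1.
Proof. by move=> kl; rewrite lef_pV2 ?posrE// ler_nat. Qed.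

Lemma cvg_local_uniform (w : nat -> R -> R) u :
  (forall (k : nat) x, `|x| <= k%:R -> `|w k x - u x| <= k.+1%:R^-1) ->
  forall x, w ^~ x @ \oo --> u x.
Proof.
move=> wu x; apply/cvgrPdist_le => /= e e0; near=> k.
rewrite distrC; apply: (@le_trans _ _ k.+1%:R^-1).
  apply: wu; apply: ltW; apply: lt_le_trans (truncnS_gt _) _.
  by rewrite ler_nat; near: k; exact: nbhs_infty_ge.
by apply: ltW; near: k; exact: (near_infty_natSinv_lt (PosNum e0)).
Unshelve. all: by end_near. Qed.

(** Lower semicontinuity of the kinetic energy.  The derivatives of the functions
    that are 1/(k+1)-close to u on [-k, k] form decreasing convex sets to which
    [nested_convex_min] applies; the increments of the corresponding functions
    converge both to those of u and to the integrals of the L2 limit. *)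
Lemma L2_primitive_limit (w h : nat -> R -> R) u (D : R) :
  (forall k, is_L2_primitive (w k) (h k)) ->
  (forall (k : nat) x, `|x| <= k%:R -> `|w k x - u x| <= k.+1%:R^-1) ->
  (forall k (e : R), 0 < e ->
    exists2 l, (k <= l)%N & (sqint mu (h l) <= (D + e)%:E)%E) ->
  exists2 g, is_L2_primitive u g & (sqint mu g <= D%:E)%E.
Proof.
move=> wh wu hD.
pose K (k : nat) : set (R -> R) := [set f | exists2 v, is_L2_primitive v f &
  forall x, `|x| <= k%:R -> `|v x - u x| <= k.+1%:R^-1].
have mK k f : K k f -> measurable_fun setT f by case=> v [].
have Kle k l : (k <= l)%N -> K l `<=` K k.
  move=> kl f [v vf vu]; exists v => // x xk; apply: le_trans (invS_le kl).
  by apply: vu; apply: le_trans xk _; rewrite ler_nat.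
have Kmid k f g : K k f -> K k g -> K k (fun x => 2^-1 * (f x + g x)).
  move=> [v vf vu] [v' vg vu']; exists (fun x => 2^-1 * (v x + v' x)).
    by apply: L2_primitiveZ; exact: L2_primitiveD.
  move=> x xk; have := vu x xk; have := vu' x xk; rewrite !ler_norml => /andP[a1 a2] /andP[b1 b2].
  by apply/andP; split; move: a1 a2 b1 b2; move: (k.+1%:R^-1) => q; lra.
have Kne k (e : R) : 0 < e -> exists2 g, K k g & (sqint mu g <= (D + e)%:E)%E.
  move=> e0; have [l kl hl] := hD k e e0; exists (h l) => //.
  by apply: (Kle _ _ kl); exists (w l) => //; exact: wu.
have [g [mg gD] [f Kf gf]] :=
  @nested_convex_min _ _ _ mu K D mK Kle Kmid Kne.
exists g => //.
have gfin : (sqint mu g < +oo)%E by apply: le_lt_trans gD _; rewrite ltry.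
split => // x y xy.
have /choice[v vP] : forall i : nat, exists v : R -> R, is_L2_primitive v (f i) /\
    forall x, `|x| <= i%:R -> `|v x - u x| <= i.+1%:R^-1.
  by move=> i; have [v v1 v2] := Kf i; exists v.
have vu := cvg_local_uniform (fun i => (vP i).2).
have c1 : v i y - v i x @[i --> \oo] --> u y - u x by apply: cvgB; exact: vu.
suff c2 : v i y - v i x @[i --> \oo] --> \int[mu]_(t in `[x, y]) g t.
  exact: (cvg_unique _ c1 c2).
have bd i : `|\int[mu]_(t in `[x, y]) g t - (v i y - v i x)| <= geometric (y - x + 1) 2^-1 i.
  have [mf ffin vE] := (vP i).1.
  rewrite vE// -RintegralB//; try by apply: locally_integrable_itv; exact: L2_locally_integrable.
  have gffin : (sqint mu (g \- f i)%R < +oo)%E by apply: le_lt_trans (gf i) _; rewrite ltry.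
  have := cauchy_schwarz_itv (measurable_funB mg mf) gffin xy.
  have : fine (sqint mu (g \- f i)%R) <= 4^-1 ^+ i.
    by rewrite -lee_fin fineK// ge0_fin_numE// sqint_ge0.
  rewrite /= (_ : (4^-1 : R) = 2^-1 ^+ 2); last by field.
  rewrite -exprM mulnC exprM; have : 0 <= (2^-1 : R) ^+ i by rewrite exprn_ge0.
  move: (2^-1 ^+ i) (fine _) (\int[mu]_(t in _) _) => q s I q0 sq HI.
  have : `|I| ^+ 2 <= ((y - x + 1) * q) ^+ 2.
    rewrite real_normK ?num_real//; apply: le_trans HI _.
    apply: (@le_trans _ _ ((y - x) * q ^+ 2)); first by rewrite ler_wpM2l// subr_ge0.
    by rewrite exprMn ler_wpM2r ?sqr_ge0//; nra.
  by rewrite ler_pXn2r// nnegrE mulr_ge0//; lra.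
have q2 : `|2^-1 : R| < 1 by rewrite ger0_norm; lra.
apply/cvgrPdist_le => /= e e0.
have /cvgr_lt/(_ _ e0) := @cvg_geometric R (y - x + 1) _ q2.
by apply: filterS => i /ltW; exact: le_trans.
Qed.

Lemma le_of_scaled_sq (C t : R) (N : nat) : 0 <= C -> 0 <= t -> (N ^ 2)%:R * (t * t) <= C ->
  N%:R * t <= C + 1.
Proof.
move=> C0 t0; rewrite natrX => H.
have : (N%:R * t) ^+ 2 <= (C + 1) ^+ 2 by rewrite exprMn expr2 [t ^+ 2]expr2 -expr2; nra.
by rewrite ler_pXn2r// nnegrE; [rewrite mulr_ge0|lra].
Qed.

(** The cutoff is a perfect square N^2 so that the bound N^2 t^2 <= C on the mass t
    becomes t <= (C + 1) / N without square roots. *)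
Lemma tail_mass v (A : set R) (C : R) (N : nat) : measurable_fun setT v ->
  measurable A -> (sqint mu v <= 1)%E ->
  (coulomb (fun x => (v x ^+ 2)%R) <= C%:E)%E -> (0 < N)%N ->
  (forall x y, A x -> A y -> (N ^ 2)%:R <= G x y) ->
  (\int[mu]_(x in A) (v x ^+ 2)%:E <= ((C + 1) / N%:R)%:E)%E.
Proof.
move=> mv mA v1 vC N0 AG.
have mv2 : measurable_fun setT (fun x => v x ^+ 2) by exact: measurable_funX.
have := coulomb_tail mv2 (fun x => sqr_ge0 (v x)) mA (ler0n R (N ^ 2)) AG.
have i0 : (0 <= \int[mu]_(x in A) (v x ^+ 2)%:E)%E.
  by apply: integral_ge0 => x _; rewrite lee_fin sqr_ge0.
have ifin : (\int[mu]_(x in A) (v x ^+ 2)%:E)%E \is a fin_num.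
  rewrite ge0_fin_numE//; apply: (@le_lt_trans _ _ 1%E); last by rewrite ltry.
  apply: le_trans v1; apply: ge0_subset_integral => //; first exact: measurable_sqE.
  by move=> x _; rewrite lee_fin sqr_ge0.
move=> /le_trans/(_ vC).
move: ifin i0; case: (\int[mu]_(x in A) _)%E => // t _; rewrite -!EFinM !lee_fin => t0 H.
have C0 : 0 <= C by apply: le_trans H; rewrite !mulr_ge0.
by rewrite ler_pdivlMr ?ltr0n// mulrC; exact: le_of_scaled_sq.
Qed.

Lemma sqint_split v (T : R) : measurable_fun setT v -> 0 <= T ->
  (sqint mu v = \int[mu]_(x in `[(- T)%R, T]) (v x ^+ 2)%:E +
    (\int[mu]_(x in `]-oo, (- T)%R[) (v x ^+ 2)%:E +
     \int[mu]_(x in `]T, +oo[) (v x ^+ 2)%:E))%E.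
Proof.
move=> mv T0; have mv2 := measurable_sqE mv.
have v0 (A : set R) x : A x -> (0 <= (v x ^+ 2)%:E)%E by rewrite lee_fin sqr_ge0.
rewrite -ge0_integral_setU//; last 3 first.
- exact: measurable_funTS.
- by move=> x _; rewrite lee_fin sqr_ge0.
- apply/disj_set2P/seteqP; split => // x /=; rewrite !in_itv/= => -[xT]; rewrite andbT; lra.
rewrite -ge0_integral_setU//; last 4 first.
- exact: measurableU.
- exact: measurable_funTS.
- by move=> x _; rewrite lee_fin sqr_ge0.
- apply/disj_set2P/seteqP; split => // x /=; rewrite !in_itv/= => -[/andP[? ?]] [|/andP[? _]]; lra.
congr (\int[mu]_(x in _) _)%E; apply/seteqP; split => // x _ /=; rewrite !in_itv/= andbT.
by case: (ltP x (- T)) => xT; [right; left|case: (ltP T x) => Tx; [right; right|left]].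
Qed.

(** Fatou gives mass at most 1.  Conversely, outside a large interval [-T, T] the
    functions [w k] carry little mass, and on [-T, T] they are close to u, so u
    carries almost all of their mass. *)
Lemma limit_mass (w : nat -> R -> R) u (C S : R) :
  (forall k, measurable_fun setT (w k)) -> measurable_fun setT u ->
  (forall k x, `|w k x| <= S) -> (forall k, sqint mu (w k) = 1%E) ->
  (forall k, (coulomb (fun x => (w k x ^+ 2)%R) <= C%:E)%E) ->
  (forall (k : nat) x, `|x| <= k%:R -> `|w k x - u x| <= k.+1%:R^-1) ->
  sqint mu u = 1%E.
Proof.
move=> mw mu_ wS w1 wC wu.
have u1 : (sqint mu u <= 1)%E.
  have mw2 k : measurable_fun setT (fun x => w k x ^+ 2) by exact: measurable_funX.
  have mu2 : measurable_fun setT (fun x => u x ^+ 2) by exact: measurable_funX.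
  apply: (@fatou_ae _ _ _ mu (fun k x => w k x ^+ 2)).
  - exact: mw2.
  - by move=> k x; exact: sqr_ge0.
  - exact: mu2.
  - by move=> x; exact: sqr_ge0.
  - apply: aeW => x; under eq_fun do rewrite expr2; rewrite expr2.
    by apply: cvgM; exact: cvg_local_uniform wu x.
  - by apply: nearW => k; rewrite -(w1 k).
apply/eqP; rewrite eq_le u1 /=; apply/lee_addgt0Pr => e e0.
have C0 : 0 <= C.
  by rewrite -lee_fin; apply: le_trans (wC 0%N); apply: coulomb_ge0 => x; exact: sqr_ge0.
have S0 : 0 <= S by apply: le_trans (wS 0%N 0).
(* N makes each of the two tails at most e / 4; afterwards k makes the change of
   mass on [-T, T] at most e / 2. *)
pose N := (Num.truncn (4 * (C + 1) / e)).+1.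
have Ne : (C + 1) / N%:R <= e / 4.
  have := truncnS_gt (4 * (C + 1) / e); rewrite -/N ltr_pdivrMr// => H.
  by rewrite ler_pdivrMr ?ltr0n//; lra.
pose T : R := (N ^ 2)%:R.
pose b := 2 * T * (2 * S + 1).
have T0 : 0 <= T by rewrite ler0n.
have b0 : 0 <= b by rewrite !mulr_ge0//; lra.
pose k := maxn (N ^ 2) (Num.truncn (2 * b / e)).+1.
have kT : T <= k%:R by rewrite ler_nat leq_maxl.
have kb : b * k.+1%:R^-1 <= e / 2.
  rewrite ler_pdivrMr//.
  have h1 : (Num.truncn (2 * b / e)).+1%:R <= k.+1%:R :> R by rewrite ler_nat ltnW// ltnS leq_maxr.
  have := truncnS_gt (2 * b / e); rewrite ltr_pdivrMr//; nra.
rewrite -(w1 k) (sqint_split (mw k) T0).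
have tl A : measurable A -> (forall x y, A x -> A y -> T <= G x y) ->
    (\int[mu]_(x in A) (w k x ^+ 2)%:E <= (e / 4)%:E)%E.
  move=> mA AG; apply: le_trans (_ : (((C + 1) / N%:R)%:E <= _)%E).
    by apply: tail_mass => //; rewrite w1.
  by rewrite lee_fin.
have t1 : (\int[mu]_(x in `]-oo, (- T)%R[) (w k x ^+ 2)%:E <= (e / 4)%:E)%E.
  by apply: tl => // x y /=; rewrite !in_itv/= => xT yT; apply: G_ge; right; split; exact: ltW.
have t2 : (\int[mu]_(x in `]T, +oo[) (w k x ^+ 2)%:E <= (e / 4)%:E)%E.
  apply: tl => // x y /=; rewrite !in_itv/= !andbT => xT yT.
  by apply: G_ge; left; split; exact: ltW.
have t3 : (\int[mu]_(x in `[(- T)%R, T]) (w k x ^+ 2)%:E <= sqint mu u + (e / 2)%:E)%E.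
  have mu2 := measurable_sqE mu_; have mwk2 := measurable_sqE (mw k).
  pose c := (2 * S + 1) * k.+1%:R^-1.
  have c0 : 0 <= c by rewrite mulr_ge0//; lra.
  apply: (@le_trans _ _ (\int[mu]_(x in `[(- T)%R, T]) ((u x ^+ 2)%:E + c%:E))%E).
    apply: ge0_le_integral => //.
    - by move=> x _; rewrite lee_fin sqr_ge0.
    - exact: measurable_funTS.
    - by apply: emeasurable_funD => //; exact: measurable_funTS.
    move=> x /=; rewrite in_itv/= -ler_norml => xT.
    have := wu k x (le_trans xT kT); have := wS k x; rewrite -EFinD lee_fin /c.
    have := invS_le1 k; have : 0 <= k.+1%:R^-1 :> R by [].
    move: (k.+1%:R^-1) (w k x) (u x) => q a d q0 q1.
    rewrite !ler_norml => /andP[? ?] /andP[? ?].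
    have -> : a ^+ 2 = d ^+ 2 + (a - d) * (a + d) by ring.
    rewrite lerD2l; apply: le_trans (ler_norm _) _; rewrite normrM.
    rewrite mulrC; apply: ler_pM => //; rewrite ler_norml; apply/andP; split; lra.
  rewrite ge0_integralD//; last 2 first.
  - by move=> x _; rewrite lee_fin sqr_ge0.
  - exact: measurable_funTS.
  apply: leeD.
    by apply: ge0_subset_integral => // x _; rewrite lee_fin sqr_ge0.
  rewrite (@integral_cst _ _ _ mu `[- T, T]%classic (measurable_itv _) c%:E).
  rewrite /= lebesgue_measure_itv/= lte_fin; case: ifPn => _.
    rewrite -EFinB -EFinM lee_fin opprK; apply: le_trans kb.
    by rewrite /b /c; move: (k.+1%:R^-1) => q; lra.
  by rewrite mule0 lee_fin divr_ge0// ltW.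
have -> : (e%:E = (e / 2)%:E + ((e / 4)%:E + (e / 4)%:E))%E by rewrite -!EFinD; congr EFin; field.
by rewrite [leRHS]addeA; exact: leeD t3 (leeD t1 t2).
Qed.

Lemma sqint_Lnorm u : 'N[mu]_2%:E[EFin \o u]%E = ((sqint mu u) `^ 2^-1)%E.
Proof.
rewrite unlock /sqint; congr (_ `^ _)%E; apply: eq_integral => x _ /=.
by rewrite powR_mulrn// real_normK ?num_real.
Qed.

Lemma sqint_Lnorm1 u : 'N[mu]_2%:E[EFin \o u]%E = 1%E -> sqint mu u = 1%E.
Proof.
rewrite sqint_Lnorm => H.
have : ((sqint mu u `^ 2^-1) `^ 2 = 1 `^ 2)%E by rewrite H.
by rewrite poweR1r -poweRrM mulVf// poweRe1// sqint_ge0.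
Qed.

Lemma integrable_sqint_lty u : mu.-integrable setT (EFin \o (fun x => u x ^+ 2)) ->
  (sqint mu u < +oo)%E.
Proof.
move=> /integrableP[_]; apply: le_lt_trans; rewrite le_eqVlt; apply/orP; left.
by apply/eqP; apply: eq_integral => x _; rewrite /= ger0_norm ?sqr_ge0.
Qed.

Lemma Lfun2P u : measurable_fun setT u -> (sqint mu u < +oo)%E ->
  u \in Lfun mu 2%:E.
Proof.
move=> mu_ ufin; rewrite inE; apply/andP; split; rewrite inE//=.
by rewrite /finite_norm sqint_Lnorm poweR_lty.
Qed.

Lemma Lfun2_measurable u : u \in Lfun mu 2%:E -> measurable_fun setT u.
Proof. by rewrite inE => /andP[]; rewrite inE. Qed.

Lemma Lfun2_sqint u : u \in Lfun mu 2%:E -> (sqint mu u < +oo)%E.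
Proof.
by move=> uL; apply: integrable_sqint_lty; exact: Lfun2_integrable_sqr.
Qed.

Lemma energyE u g : is_weak_derivative u g ->
  energy u = (sqint mu g + coulomb (fun x => (u x ^+ 2)%R))%E.
Proof.
move=> ug; rewrite /energy; congr (_ + _)%E.
have wu : is_weak_derivative u (weak_derivative u) by apply: (@xgetPex _ _ [set g | is_weak_derivative u g]); exists g.
have [_ [mw _ _] _] := wu; have [_ [mg _ _] _] := ug.
have -> : (\int[mu]_x (`|weak_derivative u x| ^+ 2)%R%:E = sqint mu (weak_derivative u))%E.
  by apply: eq_integral => x _; rewrite real_normK ?num_real.
apply: ge0_ae_eq_integral => //.
- exact: measurable_sqE.
- exact: measurable_sqE.
- by move=> x _; rewrite lee_fin sqr_ge0.
- by move=> x _; rewrite lee_fin sqr_ge0.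
by apply: ae_imp (weak_derivative_unique wu ug) => x -> _.
Qed.

Lemma L2_primitive_B1 u g : is_L2_primitive u g -> sqint mu u = 1%E ->
  (coulomb (fun x => (u x ^+ 2)%R) < +oo)%E -> B1 u.
Proof.
move=> ug u1 uC; have [mg gfin _] := ug.
have mu_ : measurable_fun setT u.
  by apply: continuous_measurable_fun; exact: L2_primitive_continuous ug.
split; last by rewrite sqint_Lnorm u1 poweR1r.
split => //; split; first by apply: Lfun2P; rewrite // u1 ltry.
by exists g; [exact: L2_primitive_weak_derivative|exact: Lfun2P].
Qed.

Lemma sqint_bounded_support v : continuous v -> bounded_support v ->
  (sqint mu v < +oo)%E.
Proof.
move=> cv sv.
have := integrable_mul_bounded_support (continuous_locally_integrable cv) cv sv.
have -> : (fun x => v x * v x) = (fun x => v x ^+ 2) by apply/funext => x; rewrite expr2.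
exact: integrable_sqint_lty.
Qed.

Lemma test_function_L2_primitive phi : test_function phi ->
  is_L2_primitive phi (derive1 phi).
Proof.
move=> [dphi cd [M phiM]]; split.
- exact: continuous_measurable_fun.
- by apply: sqint_bounded_support => //; exists M; exact: derive1_out.
- by move=> x y xy; rewrite (Rintegral_derive1 xy dphi cd).
Qed.

(** A test function with nonzero integral has nonzero mass, by Cauchy-Schwarz on
    its support, and can be normalized. *)
Lemma admissible_finite_energy : exists2 v : R -> R, B1 v & (energy v < +oo)%E.
Proof.
have [phi tphi phi0] := exists_test_mass (R := R).
have cphi := test_function_continuous tphi; have [_ _ [M phiM]] := tphi.
have mphi : measurable_fun setT phi by exact: continuous_measurable_fun.
have sfin : (sqint mu phi < +oo)%E by apply: sqint_bounded_support => //; exists M.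
have sE : sqint mu phi = (fine (sqint mu phi))%:E.
  by rewrite fineK// ge0_fin_numE// sqint_ge0.
have phiN : forall x, `|M| < `|x| -> phi x = 0.
  by move=> x Mx; apply: phiM; apply: le_lt_trans Mx; exact: ler_norm.
have s0 : 0 < fine (sqint mu phi).
  have NMM : - `|M| <= `|M| by have := normr_ge0 M; lra.
  have := cauchy_schwarz_itv mphi sfin NMM.
  have := Rintegral_mul_bounded_support (cst 1) phiN.
  under eq_Rintegral do rewrite mul1r.
  under [in X in _ = X]eq_Rintegral do rewrite mul1r.
  move=> <-; rewrite lt_neqAle fine_ge0 ?sqint_ge0// andbT eq_sym.
  apply: contraTneq => ->; rewrite mulr0 -ltNge.
  by rewrite lt_neqAle sqr_ge0 andbT eq_sym sqrf_eq0.
pose c := (Num.sqrt (fine (sqint mu phi)))^-1.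
have cs : c ^+ 2 * fine (sqint mu phi) = 1.
  by rewrite exprVn sqr_sqrtr ?ltW// mulVf// gt_eqF.
have vP := L2_primitiveZ c (test_function_L2_primitive tphi).
set v := fun x => c * phi x in vP; set g := fun x => c * derive1 phi x in vP.
have v1 : sqint mu v = 1%E by rewrite sqintZ// sE -EFinM cs.
have mv : measurable_fun setT v by exact: measurable_funM.
have Cfin : (coulomb (fun x => (v x ^+ 2)%R) < +oo)%E.
  apply: (@le_lt_trans _ _ (`|M|%:E * (1 * 1))%E); last by rewrite !mule1 ltry.
  rewrite -v1; apply: coulomb_bounded_support => //.
  - exact: measurable_funX.
  - by move=> x; exact: sqr_ge0.
  - by move=> x Mx; rewrite /v phiN// mulr0 expr0n.
exists v; first exact: L2_primitive_B1 vP v1 Cfin.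
rewrite (energyE (L2_primitive_weak_derivative vP)).
by apply: lte_add_pinfty => //; case: vP.
Qed.

Lemma energy_ge0 u : (0 <= energy u)%E.
Proof.
apply: adde_ge0; first by apply: integral_ge0 => x _; rewrite lee_fin exprn_ge0.
by apply: coulomb_ge0 => x; exact: sqr_ge0.
Qed.

Lemma e0_fin_num : @e0 R \is a fin_num.
Proof.
have [v vB vE] := admissible_finite_energy.
rewrite ge0_fin_numE; first by apply: le_lt_trans vE; apply: ereal_inf_lbound; exists v.
by apply: le_ereal_inf_tmp => _ [u _ <-]; exact: energy_ge0.
Qed.

(** Passing to the continuous representative changes neither the mass nor the
    energy. *)
Lemma near_minimizer (e : R) : 0 < e -> exists v h, [/\ is_L2_primitive v h,
  sqint mu v = 1%E &
  (sqint mu h + coulomb (fun x => (v x ^+ 2)%R) <= e0 + e%:E)%E].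
Proof.
move=> e0_; have [_ [u uB <-] uE] := lb_ereal_inf_adherent e0_ e0_fin_num.
have [[[uL [g ug gL]] uC] uN] := uB.
have mu_ := Lfun2_measurable uL.
have [v vg uv] := L2_representative ug (Lfun2_sqint gL).
have mv : measurable_fun setT v.
  by apply: continuous_measurable_fun; exact: L2_primitive_continuous vg.
exists v, g; split => //.
  rewrite -(sqint_Lnorm1 uN); apply: ge0_ae_eq_integral => //.
  - exact: measurable_sqE.
  - exact: measurable_sqE.
  - by move=> x _; rewrite lee_fin sqr_ge0.
  - by move=> x _; rewrite lee_fin sqr_ge0.
  by apply: ae_imp uv => x -> _.
rewrite (@coulomb_ae _ (fun x => v x ^+ 2) (fun x => u x ^+ 2)).
- by rewrite -(energyE ug); exact: ltW.
- exact: measurable_funX.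
- exact: measurable_funX.
- by move=> x; exact: sqr_ge0.
- by move=> x; exact: sqr_ge0.
- by apply: ae_imp uv => x ->.
Qed.

Lemma minimizing_sequence : exists u : R -> R, exists w h : nat -> R -> R,
  [/\ forall k, is_L2_primitive (w k) (h k),
      forall k, sqint mu (w k) = 1%E,
      forall k, (sqint mu (h k) + coulomb (fun x => (w k x ^+ 2)%R) <=
                e0 + (k.+1%:R^-1)%:E)%E,
      exists S : R, forall k x, `|w k x| <= S
    & forall (k : nat) x, `|x| <= k%:R -> `|w k x - u x| <= k.+1%:R^-1].
Proof.
have e0E : @e0 R = (fine (@e0 R))%:E by rewrite fineK// e0_fin_num.
have /choice[v vP] : forall n : nat, exists v : (R -> R) * (R -> R),
    [/\ is_L2_primitive v.1 v.2, sqint mu v.1 = 1%E &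
    (sqint mu v.2 + coulomb (fun x => (v.1 x ^+ 2)%R) <= e0 + (n.+1%:R^-1)%:E)%E].
  move=> n; have n0 : 0 < n.+1%:R^-1 :> R by rewrite invr_gt0.
  by have [v [h vh]] := near_minimizer n0; exists (v, h).
pose A := fine (@e0 R) + 1.
have vA n : fine (sqint mu (v n).2) <= A.
  have [[_ hfin _] _ H] := vP n.
  rewrite -lee_fin fineK ?ge0_fin_numE ?sqint_ge0//.
  apply: (@le_trans _ _ (e0 + (n.+1%:R^-1)%:E)%E).
    by apply: le_trans H; apply: leeDl; apply: coulomb_ge0 => x; exact: sqr_ge0.
  by rewrite e0E -EFinD lee_fin lerD2l invS_le1.
have vS n x : `|(v n).1 x| <= A + 3.
  by have [H1 H2 _] := vP n; apply: (L2_primitive_bounded _ H1) => //; rewrite H2.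
have vH n x y : ((v n).1 y - (v n).1 x) ^+ 2 <= `|y - x| * A.
  have [H1 _ _] := vP n; apply: le_trans (L2_primitive_hoelder_half x y H1) _.
  exact: ler_wpM2l.
have [u uP] := hoelder_precompact vS vH.
have /choice[n nP] : forall k : nat, exists n : nat, (k <= n)%N /\
    forall x, `|x| <= k%:R -> `|(v n).1 x - u x| <= k.+1%:R^-1.
  by move=> k; have [n kn nu] := uP k; exists n.
exists u, (fun k => (v (n k)).1), (fun k => (v (n k)).2); split.
- by move=> k; case: (vP (n k)).
- by move=> k; case: (vP (n k)).
- move=> k; have [_ _ H] := vP (n k); apply: le_trans H _.
  by rewrite leeD2l// lee_fin invS_le//; case: (nP k).
- by exists (A + 3) => k x.
- by move=> k; case: (nP k).
Qed.

End Minimizer.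

Theorem theorem17 (R : realType) :
  exists2 u : R -> R, B1 u & energy u = e0.
Proof.
pose mu := @lebesgue_measure R.
have e0E : @e0 R = (fine (@e0 R))%:E by rewrite fineK// e0_fin_num.
have [u [w [h [wh w1 wE [S wS] wu]]]] := @minimizing_sequence R.
set E := fine (@e0 R) in e0E.
have mw k : measurable_fun setT (w k).
  by apply: continuous_measurable_fun; exact: L2_primitive_continuous (wh k).
have cwu := cvg_local_uniform wu.
have mu_ : measurable_fun setT u.
  by apply: (@measurable_fun_cvg _ _ _ setT w) => // x _; exact: cwu.
pose Co v := coulomb (fun x : R => (v x ^+ 2)%R).
have Co0 v : (0 <= Co v)%E by apply: coulomb_ge0 => x; exact: sqr_ge0.
have wCo k : (Co (w k) <= (E + 1)%:E)%E.
  apply: (@le_trans _ _ (sqint mu (h k) + Co (w k))%E).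
    by apply: leeDr; exact: sqint_ge0.
  by apply: le_trans (wE k) _; rewrite e0E -EFinD lee_fin lerD2l invS_le1.
(* Only a bound along the tail of the sequence is assumed, so that the
   semicontinuity can be used by contradiction below. *)
have lsc (C : \bar R) : (\forall k \near \oo, Co (w k) <= C)%E -> (Co u <= C)%E.
  move=> wC; pose d v := coulomb_density (fun x : R => v x ^+ 2).
  have md v : measurable_fun setT v -> measurable_fun setT (d v).
    by move=> mv; apply: measurable_coulomb_density; exact: measurable_funX.
  have d0 v p : 0 <= d v p by apply: coulomb_density_ge0 => x; exact: sqr_ge0.
  apply: (@fatou_ae _ _ _ (mu \x mu)%E (fun k => d (w k)) (d u)) => //.
  - by move=> k; exact: md.
  - exact: md.
  apply: aeW => p; rewrite /d /coulomb_density.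
  have sq x : w k x ^+ 2 @[k --> \oo] --> u x ^+ 2.
    by under eq_fun do rewrite expr2; rewrite expr2; apply: cvgM; exact: cwu.
  by apply: cvgM => //; apply: cvgM => //; exact: cvg_cst.
have CoE : Co u = (fine (Co u))%:E.
  rewrite fineK// ge0_fin_numE//; apply: (@le_lt_trans _ _ (E + 1)%:E); last by rewrite ltry.
  by apply: lsc; exact: nearW.
set c := fine (Co u) in CoE.
(* If the kinetic energies eventually exceeded E - c + e, then the Coulomb
   energies would eventually stay below c - e / 2, against semicontinuity. *)
have freq k (e : R) : 0 < e ->
    exists2 l, (k <= l)%N & (sqint mu (h l) <= (E - c + e)%:E)%E.
  move=> ep; apply: contrapT => H.
  pose m := maxn k (Num.truncn (2 / e)).+1.
  suff : (Co u <= (c - e / 2)%:E)%E by rewrite CoE lee_fin; lra.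
  apply: lsc; exists m => // l /=; rewrite geq_max => /andP[kl el].
  have : ~ (sqint mu (h l) <= (E - c + e)%:E)%E by move=> Hl; apply: H; exists l.
  have := wE l; rewrite e0E; have := Co0 (w l); have := sqint_ge0 mu (h l).
  rewrite -/(Co (w l)).
  have le2 : l.+1%:R^-1 <= e / 2.
    have := truncnS_gt (2 / e); rewrite ltr_pdivrMr// => h1.
    have h2 : (Num.truncn (2 / e)).+1%:R <= l.+1%:R :> R by rewrite ler_nat ltnW.
    rewrite -div1r ler_pdivrMr//; nra.
  case: (Co (w l)) => [a| |]//; case: (sqint mu (h l)) => [b| |]//.
  rewrite -?EFinD !lee_fin => b0 a0 ab /negP; rewrite -ltNge.
  move: le2 ab; move: (l.+1%:R^-1) => q; clear; clearbody E c; lra.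
have [g ug gE] := L2_primitive_limit wh wu freq.
have u1 := limit_mass mw mu_ wS w1 wCo wu.
have uB : B1 u by apply: L2_primitive_B1 ug u1 _; rewrite -/(Co u) CoE ltry.
exists u => //; apply/eqP; rewrite eq_le; apply/andP; split; last first.
  by apply: ereal_inf_lbound; exists u.
rewrite (energyE (L2_primitive_weak_derivative ug)) -/(Co u) CoE e0E.
apply: (@le_trans _ _ ((E - c)%:E + c%:E)%E); first by rewrite leeD2r.
by rewrite -EFinD subrK.
Qed.
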